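(* Let $(X,F)$ be a tropical Hopf data, with $X\subseteq\mathbb{T}^n$. Then $X$ is a neighborhood of $\infty$ in a tropical variety $V\subseteq \mathbb{T}^n$ which is a cone. In particular, the map $F$ is a global automorphism of the tropical variety $V$. Moreover, the tropical Hopf manifold $S(X,F)$ is a finite quotient of a tropical modification of a diagonal tropical Hopf manifold.
   Context: $\mathbb{T}=\mathbb{R}\cup\{\infty\}$ is the min-plus tropical semifield ($x\wedge y=\min\{x,y\}$, tropical multiplication is $+$), with the topology generated by Euclidean open sets of $\mathbb{R}$ and the sets $(a,\infty]$. The point $(\infty,\dots,\infty)\in\mathbb{T}^n$ is also denoted $\infty$. A point $x\in\mathbb{T}^n$ has sedentarity $I\subseteq\{1,\dots,n\}$ if $x_i=\infty\iff i\in I$; $\mathbb{R}^n_I\cong\mathbb{R}^{n-|I|}$ is the set of points of sedentarity $I$, and $\mathbb{T}^n_I$ its closure. Tropical subvarieties. A tropical subvariety of $\mathbb{R}^n$ is a pure-dimensional finite rational polyhedral complex with positive integer weights on its facets satisfying the balancing condition. A tropical subvariety of $\mathbb{T}^n$ of sedentarity $I$ is the closure in $\mathbb{T}^n$ of a tropical subvariety of $\mathbb{R}^n_I$; a tropical subvariety of $\mathbb{T}^n$ is a union of such, of possibly different sedentarities. Non-singularity. Let $\mathbb{K}$ be a field with a non-archimedean valuation. A linear space in the affine space $\mathbb{A}^n$ over $\mathbb{K}$ is generic if its closure in $\mathbb{P}^n$ meets all intersections of coordinate hyperplanes in the expected dimension; a linear space through $0$ is generic if the same holds with the exception of the point $0$.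 Let $V\subset\mathbb{T}^n$ be a tropical variety of sedentarity $\emptyset$ and codimension $k$. For $x\in V\cap\mathbb{R}^n$ let $L_x$ be the tropicalization of a generic hyperplane, translated to have vertex $x$, $L_x^k$ its $k$-th stable self-intersection, and $\deg_V(x)=\min\{w_x(V\cdot\phi(L_x^k)) : \phi\in GL_n(\mathbb{Z})\}$, where $w_x(V\cdot L)$ is the weight of $x$ in the tropical stable intersection. With $|V\cdot L|=\sum_{x\in\mathbb{R}^n}w_x(V\cdot L)$, put $\deg_V(\infty)=|V\cdot L^k|-|V\cdot L_\infty^k|$, where $L$ (resp. $L_\infty$) is the tropicalization of a generic hyperplane (resp. generic hyperplane through $0$). $V$ is non-singular at $x$ ($x$ of sedentarity $\emptyset$, or $x=\infty$) if $\deg_V(x)=1$. $V$ is non-singular if it meets every $\mathbb{R}^n_I$, $I\subsetneq\{1,\dots,n\}$, properly (codimension of $V\cap\mathbb{R}^n_I$ in $V$ equal to $|I|$) and is non-singular at $\infty$ and at all points of empty sedentarity. A non-singular germ of a tropical subvariety is the intersection of a tropical subvariety $V\subset\mathbb{T}^n$ with a sufficiently small neighborhood of $\infty$ in which $V$ is non-singular. Modifications. Given a tropical variety $V\subset\mathbb{T}^n$ and a tropical polynomial $P:\mathbb{T}^n\to\mathbb{T}$, let $\widetilde V\subset\mathbb{T}^{n+1}$ be obtained from the graph of $P|_V$ (with weights inherited from $V$) by adding, at every codimension-one face where balancing fails, a facet in the direction $e_{n+1}$ with the unique positive weight restoring balancing. The projection $\pi_P:\widetilde V\to V$ forgetting the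 last coordinate is the regular modification of $V$ along $P$; $\mathrm{div}_V(P)\subset V$ is the image of the added facets, with their weights. For $P=P_1-P_2$ a difference of tropical polynomials, $\mathrm{div}_V(P)=\mathrm{div}_V(P_1)-\mathrm{div}_V(P_2)$; when this cycle is effective the same construction defines a rational modification. A (tropical) modification is any composition of regular or rational modifications. Hopf data. A linear monomial map $F:\mathbb{T}^n\to\mathbb{T}^n$ is a map $F(x_1,\dots,x_n)=(x_{\sigma(1)}+a_{\sigma(1)},\dots,x_{\sigma(n)}+a_{\sigma(n)})$ with $\sigma$ a permutation and $a_j\in\mathbb{R}$; it is contracting if every neighborhood $U$ of $\infty$ contains a neighborhood $V$ of $\infty$ with $\overline{F(V)}\subset V$. A tropical Hopf data is a pair $(X,F)$ where $X\subseteq\mathbb{T}^n$ is a non-singular germ of a tropical variety obtained from a modification $\pi:X\to\mathbb{T}^d$, and $F:(\mathbb{T}^n,\infty)\to(\mathbb{T}^n,\infty)$ is a linear monomial contracting map with $F(X)\subset X$. The tropical Hopf manifold $S(X,F)$ is the quotient of $X\setminus\{\infty\}$ by the action of $F$ (equivalently the quotient of $W\cap X$ for a fundamental domain $W$ of $F$ on $\mathbb{T}^n\setminus\{\infty\}$). A diagonal tropical Hopf manifold is $S(\mathbb{T}^d,F)$ with $F$ a translation by a vector with strictly positive entries. A Hopf data $(\widetilde X,\widetilde F)$ is a modification of $(X,F)$ if there is a tropical modification $\pi:\widetilde X\to X$ with $\pi\circ\widetilde F=F\circ\pi$; then $S(\widetilde X,\widetilde F)$ is called a modification of $S(X,F)$.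 Cones. A tropical variety $V\subseteq\mathbb{T}^n$ is a cone if there is $w\in(\mathbb{R}_+^* )^n$ (strictly positive entries) such that $p\in V$ implies $p+\lambda w\in V$ for all $\lambda\in\mathbb{T}$.
   Formalization: In the definition of the degree (hence of non-singularity), the power of the tropical hyperplane L intersected with V is taken to be the dimension of V rather than its codimension, so that the intersection is 0-dimensional, and φ acts around the point x, so that the vertex stays at x. *)

(* Defs.v *)
From HB Require Import structures.
From mathcomp Require Import all_boot all_order all_algebra all_fingroup finmap.
From mathcomp Require Import all_classical all_reals all_analysis.
Set Implicit Arguments.
Unset Strict Implicit.
Unset Printing Implicit Defensive.
Import Order.TTheory GRing.Theory Num.Theory.
Import numFieldNormedType.Exports.
Local Open Scope classical_set_scope.
Local Open Scope ring_scope.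
Local Open Scope quotient_scope.

Section TropicalNumbers.
Variable R : realType.

(* [None] is the tropical zero, +oo. The topology is induced by the inclusion
   into the extended reals: it is generated by the opens of [R] and the
   half-lines ]a, +oo]. *)
Definition trop_ereal (x : option R) : \bar R :=
  if x is Some r then r%:E else +oo%E.

Definition trop := initial_topology trop_ereal.
HB.instance Definition _ := Topological.copy trop (initial_topology trop_ereal).

Definition tfin (r : R) : trop := Some r.
Definition tinf : trop := None.

Definition tval (x : trop) : R := if x is Some r then r else 0.

Definition tle (x y : trop) : bool := (trop_ereal x <= trop_ereal y)%E.

Definition tmin (x y : trop) : trop := if tle x y then x else y.

Definition tmul (x y : trop) : trop :=
  if x is Some a then if y is Some b then tfin (a + b) else tinf else tinf.

(* [tspace n] is T^n, with the product topology. *)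
Definition tspace (n : nat) := 'I_n -> trop.
HB.instance Definition _ n :=
  Topological.copy (tspace n) (prod_topology (fun _ : 'I_n => trop)).

Definition tpoint_inf n : tspace n := fun=> tinf.

Definition sedentarity n (x : tspace n) : {set 'I_n} :=
  [set i | x i == None :> option R]%SET.

Definition temb n (x : 'rV[R]_n) : tspace n := fun i => tfin (x 0 i).

End TropicalNumbers.

Arguments tpoint_inf R n : clear implicits.

Section Polyhedra.
Variable R : realType.
Variable n : nat.
Implicit Types (P Q F s t : set 'rV[R]_n).

Definition dot (a x : 'rV[R]_n) : R := \sum_(i < n) a 0 i * x 0 i.

Definition zvec (z : 'rV[int]_n) : 'rV[R]_n := map_mx intr z.

Definition rational_polyhedron P :=
  exists l : seq ('rV[int]_n * R),
    P = [set x | forall h, h \in l -> h.2 <= dot (zvec h.1) x].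

Definition face F P :=
  F !=set0 /\ exists (a : 'rV[R]_n) (b : R),
    (forall x, P x -> b <= dot a x) /\ F = P `&` [set x | dot a x = b].

(* The linear space spanned by the differences of points of [P], i.e. the
   direction of its affine hull. *)
Definition lin_span P : set 'rV[R]_n :=
  [set v | exists r (M : 'M[R]_(r, n)),
    (forall i, exists x y, [/\ P x, P y & row i M = x - y]) /\ (v <= M)%MS].

Definition pdim P : nat :=
  \max_(r < n.+1 | `[< exists M : 'M[R]_(r, n), row_free M /\
      forall i, exists x y, [/\ P x, P y & row i M = x - y] >]) r.

(* Algebraic interior relative to the affine hull, for convex [P]. *)
Definition relint P : set 'rV[R]_n :=
  [set x | P x /\ forall y, P y -> exists2 e : R, 0 < e & P (x - e *: (y - x))].

(* [S] has dimension [k], for [S] a union of polyhedra or a relatively open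
   piece of one. *)
Definition set_dim (S : set 'rV[R]_n) (k : nat) :=
  (exists P, [/\ rational_polyhedron P, P !=set0, P `<=` S & pdim P = k]) /\
  (forall P, rational_polyhedron P -> P !=set0 -> P `<=` S -> (pdim P <= k)%N).

(* Only the values of [weight] on facets are meaningful. *)
Record wcomplex := WComplex {
  cells : set (set 'rV[R]_n);
  weight : set 'rV[R]_n -> nat }.

Definition support (C : wcomplex) : set 'rV[R]_n := \bigcup_(P in cells C) P.

Definition facets (d : nat) (C : wcomplex) : set (set 'rV[R]_n) :=
  [set P | cells C P /\ pdim P = d].

Definition ridges (d : nat) (C : wcomplex) : set (set 'rV[R]_n) :=
  [set P | cells C P /\ (pdim P).+1 = d].

Definition facets_at (d : nat) (C : wcomplex) t : set (set 'rV[R]_n) :=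
  facets d C `&` [set s | t `<=` s].

Definition polyhedral_complex (C : wcomplex) :=
  [/\ finite_set (cells C),
      forall P, cells C P -> P !=set0 /\ rational_polyhedron P,
      forall P F, cells C P -> face F P -> cells C F
    & forall P Q, cells C P -> cells C Q -> P `&` Q !=set0 ->
        face (P `&` Q) P /\ face (P `&` Q) Q].

(* Finite rational polyhedral complex, pure of dimension [d], with positive
   weights on its facets. *)
Definition weighted_complex (d : nat) (C : wcomplex) :=
  [/\ polyhedral_complex C,
      forall P, cells C P -> exists2 Q, facets d C Q & P `<=` Q
    & forall P, facets d C P -> (0 < weight C P)%N].

(* [u] is an integer vector pointing from the ridge [t] into [s], and it
   generates the lattice of [s] modulo that of [t]. *)
Definition prim_gen t s (u : 'rV[int]_n) :=
  [/\ lin_span s (zvec u),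
      forall z : 'rV[int]_n, lin_span s (zvec z) ->
        exists k : int, lin_span t (zvec (z - k *: u))
    & exists x, exists2 e : R, t x & 0 < e /\ s (x + e *: zvec u)].

Definition balanced_at (d : nat) (C : wcomplex) t :=
  exists u : set 'rV[R]_n -> 'rV[int]_n,
    (forall s, facets_at d C t s -> prim_gen t s (u s)) /\
    lin_span t (\sum_(s \in facets_at d C t) (weight C s)%:R *: zvec (u s)).

Definition tropical_subvariety (d : nat) (C : wcomplex) :=
  weighted_complex d C /\ forall t, ridges d C t -> balanced_at d C t.

Definition same_weights (d : nat) (A B : wcomplex) (D : set 'rV[R]_n) :=
  forall P Q x, facets d A P -> facets d B Q -> relint P x -> relint Q x ->
    D x -> weight A P = weight B Q.

(* Two complexes are the same subvariety when they differ by subdivision. *)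
Definition same_cycle (d : nat) (A B : wcomplex) :=
  [/\ weighted_complex d A, weighted_complex d B, support A = support B
    & same_weights d A B setT].

Definition full_complex : wcomplex := WComplex [set setT] (fun=> 1%N).

Definition map_complex (f : 'rV[R]_n -> 'rV[R]_n) (C : wcomplex) : wcomplex :=
  WComplex [set f @` P | P in cells C] (fun Q => weight C (f @^-1` Q)).

Definition in_sum_span s t (v : 'rV[R]_n) :=
  exists a b, [/\ lin_span s a, lin_span t b & v = a + b].

Definition transverse s t := forall v, in_sum_span s t v.

Definition generic_displacement (A B : wcomplex) (v : 'rV[R]_n) :=
  forall s t, cells A s -> cells B t -> in_sum_span s t v -> transverse s t.

Definition meets_displaced s t (v : 'rV[R]_n) :=
  exists2 e0 : R, 0 < e0 &
    forall e, 0 < e < e0 -> exists x, s x /\ t (x - e *: v).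

(* [Z^n : N_s + N_t], the number of cosets; it is finite when [s] and [t] are
   transverse rational polyhedra ([fset_set] of an infinite set is empty). *)
Definition lattice_sum s t : set 'rV[int]_n :=
  [set z | exists a b : 'rV[int]_n,
    [/\ lin_span s (zvec a), lin_span t (zvec b) & z = a + b]].

Definition lattice_index s t : nat :=
  #|` fset_set [set [set y | lattice_sum s t (y - z)] | z in [set: 'rV[int]_n]]|.

(* Fan displacement rule: the facets of [A] and [B] through [x] that meet
   transversally and still meet after a small displacement of [B] by [v]. *)
Definition stable_mult (d : nat) (A : wcomplex) (e : nat) (B : wcomplex)
    (v x : 'rV[R]_n) : nat :=
  (\sum_(p \in [set p : set 'rV[R]_n * set 'rV[R]_n |
      [/\ facets d A p.1, facets e B p.2, p.1 x /\ p.2 x,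
          transverse p.1 p.2 & meets_displaced p.1 p.2 v]])
    (weight A p.1 * weight B p.2 * lattice_index p.1 p.2))%N.

Definition subordinate (C A : wcomplex) :=
  forall P s, cells C P -> cells A s -> P `&` s !=set0 -> face (P `&` s) P.

(* [C] is the stable intersection of [A] (dimension [d]) and [B] (dimension
   [e]). The displacement formula gives the weight of a facet only where the
   facets of [A] and [B] through [x] contain that facet, hence [subordinate].
   If [d + e < n] then [C] is empty. *)
Definition stable_intersection (d : nat) (A : wcomplex) (e : nat) (B : wcomplex)
    (C : wcomplex) :=
  [/\ weighted_complex (d + e - n) C, subordinate C A, subordinate C B
    & forall v, generic_displacement A B v ->
        support C = [set x | (0 < stable_mult d A e B v x)%N] /\
        forall P x, facets (d + e - n) C P -> relint P x ->
          weight C P = stable_mult d A e B v x].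

(* [C] is the [k]-th stable self-intersection of the hypersurface [L]. *)
Fixpoint stable_power (L : wcomplex) (k : nat) (C : wcomplex) : Prop :=
  if k is k'.+1 then
    exists2 C', stable_power L k' C' &
      stable_intersection (n - k') C' n.-1 L C
  else C = full_complex.

Definition point_weight (C : wcomplex) (x : 'rV[R]_n) : nat :=
  if `[< cells C [set x] >] then weight C [set x] else 0%N.

Definition total_weight (C : wcomplex) : nat :=
  (\sum_(x \in [set: 'rV[R]_n]) point_weight C x)%N.

Definition tclosure (C : wcomplex) : set (tspace R n) :=
  closure (@temb R n @` support C).

End Polyhedra.

Section Nonsingularity.
Variable R : realType.
Variable K : fieldType.

Definition valuation (v : K -> trop R) :=
  [/\ forall x, v x = tinf R <-> x = 0,
      forall x y, v (x * y) = tmul (v x) (v y)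
    & forall x y, tle (tmin (v x) (v y)) (v (x + y))].

Variable v : K -> trop R.
Variable n : nat.

(* The row [a] stands for the affine hyperplane a_0 + a_1 x_1 + ... + a_n x_n = 0;
   [a] also gives the equation of its closure in P^n. [section_rank a J] is one
   more than the dimension of the intersection of that closure with the
   coordinate hyperplanes indexed by [J]. *)
Definition section_rank (a : 'rV[K]_n.+1) (J : {set 'I_n.+1}) : nat :=
  \rank (kermx a^T :&: diag_mx (\row_j (j \notin J)%:R))%MS.

Definition generic_hyperplane (a : 'rV[K]_n.+1) :=
  forall J : {set 'I_n.+1}, section_rank a J = (n - #|J|)%N.

(* The point 0 is the intersection of the coordinate hyperplanes 1, ..., n. *)
Definition generic_hyperplane0 (a : 'rV[K]_n.+1) :=
  a 0 ord0 = 0 /\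
  forall J : {set 'I_n.+1}, J != [set~ ord0]%SET -> section_rank a J = (n - #|J|)%N.

Definition homog (x : 'rV[R]_n) (i : 'I_n.+1) : R :=
  if unlift ord0 i is Some j then x 0 j else 0.

Definition trop_term (a : 'rV[K]_n.+1) (x : 'rV[R]_n) (i : 'I_n.+1) : trop R :=
  tmul (v (a 0 i)) (tfin (homog x i)).

(* The points where every term indexed by [J] attains the minimum. *)
Definition min_cell (a : 'rV[K]_n.+1) (J : {set 'I_n.+1}) : set 'rV[R]_n :=
  [set x | forall i j, i \in J -> tle (trop_term a x i) (trop_term a x j)].

(* The points where the minimum of the tropicalized equation is attained at
   least twice. The exponents being those of an affine form, the dual edges
   have lattice length 1 and so have all the weights. *)
Definition trop_hyperplane (a : 'rV[K]_n.+1) : wcomplex R n :=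
  WComplex [set min_cell a J | J in [set J : {set 'I_n.+1} |
      (1 < #|J|)%N /\ forall i, i \in J -> a 0 i != 0]]
    (fun=> 1%N).

(* [w] is the weight of [x] in V . phi(L_x^d), with L_x^d centred at [x] and
   [phi] acting around [x]. *)
Definition local_weight (d : nat) (V : wcomplex R n) (x : 'rV[R]_n)
    (phi : 'M[int]_n) (w : nat) :=
  exists (a : 'rV[K]_n.+1) (p : 'rV[R]_n) (Ld I : wcomplex R n),
    [/\ generic_hyperplane a, min_cell a [set: 'I_n.+1]%SET = [set p],
        stable_power (trop_hyperplane a) d Ld,
        stable_intersection d V (n - d)
          (map_complex (fun y => x + (y - p) *m map_mx intr phi) Ld) I
      & w = point_weight I x].

Definition degree_at (d : nat) (V : wcomplex R n) (x : 'rV[R]_n) (m : nat) :=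
  (exists2 phi : 'M[int]_n, phi \in unitmx & local_weight d V x phi m) /\
  (forall (phi : 'M[int]_n) w, phi \in unitmx -> local_weight d V x phi w ->
     (m <= w)%N).

Definition degree_infty (d : nat) (V : wcomplex R n) (m : int) :=
  exists (a b : 'rV[K]_n.+1) (La Lb Ia Ib : wcomplex R n),
    [/\ generic_hyperplane a /\ generic_hyperplane0 b,
        stable_power (trop_hyperplane a) d La /\
        stable_power (trop_hyperplane b) d Lb,
        stable_intersection d V (n - d) La Ia,
        stable_intersection d V (n - d) Lb Ib
      & m = (total_weight Ia)%:Z - (total_weight Ib)%:Z].

(* The part of [X] of sedentarity [I]; R^n_I is seen in R^n by replacing the
   infinite coordinates by 0. *)
Definition stratum (X : set (tspace R n)) (I : {set 'I_n}) : set 'rV[R]_n :=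
  [set y | exists x, [/\ X x, sedentarity x = I & y = \row_i tval (x i)]].

Definition meets_properly (d : nat) (X : set (tspace R n)) (I : {set 'I_n}) :=
  stratum X I = set0 \/ exists2 k, (#|I| + k)%N = d & set_dim (stratum X I) k.

Definition nonsingular_in (d : nat) (V : wcomplex R n) (U : set (tspace R n)) :=
  [/\ forall I : {set 'I_n}, I \proper [set: 'I_n]%SET ->
        meets_properly d (tclosure V `&` U) I,
      degree_infty d V 1
    & forall x, support V x -> U (temb x) -> degree_at d V x 1].

End Nonsingularity.

Section Modifications.
Variable R : realType.

(* A tropical polynomial other than the constant +oo, restricted to R^n: a
   minimum of finitely many monomials with real coefficients. *)
Definition tmonomial n (m : R * {ffun 'I_n -> nat}) (x : 'rV[R]_n) : R :=
  m.1 + \sum_(i < n) x 0 i *+ m.2 i.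

Definition tropical_polynomial n (P : 'rV[R]_n -> R) :=
  exists l : seq (R * {ffun 'I_n -> nat}), forall x,
    (forall m, m \in l -> P x <= tmonomial m x) /\
    (exists2 m, m \in l & P x = tmonomial m x).

Definition affine_on n (P : 'rV[R]_n -> R) (s : set 'rV[R]_n) :=
  exists (a : 'rV[R]_n) (b : R), forall x, s x -> P x = dot a x + b.

Definition forget_last n (x : 'rV[R]_n.+1) : 'rV[R]_n :=
  \row_i x 0 (lift ord_max i).

Definition graph_over n (P : 'rV[R]_n -> R) (s : set 'rV[R]_n) :
    set 'rV[R]_n.+1 :=
  [set y | s (forget_last y) /\ y 0 ord_max = P (forget_last y)].

(* The graph over [t] plus the half-line in the direction of the last basis
   vector. *)
Definition upper_graph n (P : 'rV[R]_n -> R) (t : set 'rV[R]_n) :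
    set 'rV[R]_n.+1 :=
  [set y | t (forget_last y) /\ P (forget_last y) <= y 0 ord_max].

(* [m] is the weight with which the facet [upper_graph P t] restores balancing
   of the graph of [P] along [t], i.e. the weight of [t] in div_V(P). *)
Definition div_weight n (d : nat) (V : wcomplex R n) (P : 'rV[R]_n -> R)
    (t : set 'rV[R]_n) (m : int) :=
  exists u : set 'rV[R]_n -> 'rV[int]_n.+1,
    (forall s, facets_at d V t s ->
       prim_gen (graph_over P t) (graph_over P s) (u s)) /\
    lin_span (graph_over P t)
      (\sum_(s \in facets_at d V t) (weight V s)%:R *: zvec R (u s)
       + m%:~R *: delta_mx 0 ord_max).

Definition modified_complex n (d : nat) (V : wcomplex R n) (P : 'rV[R]_n -> R)
    (mu : set 'rV[R]_n -> nat) : wcomplex R n.+1 :=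
  WComplex
    ([set graph_over P s | s in cells V] `|`
     [set upper_graph P r | r in [set r | cells V r /\
        exists t, [/\ ridges d V t, (0 < mu t)%N & r `<=` t]]])
    (fun Q => let s := @forget_last n @` Q in
       if `[< Q = graph_over P s >] then weight V s else mu s).

(* The modification of [V] along [P1 - P2], on a subdivision [V'] of [V] whose
   cells carry affine restrictions of [P1] and [P2]. That [mu] takes values in
   [nat] is the effectivity of div_V(P1) - div_V(P2). A regular modification is
   the case where [P2] is the constant polynomial 0, whose divisor is 0. *)
Definition elementary_modification n (d : nat) (V : wcomplex R n)
    (W : wcomplex R n.+1) :=
  exists (P1 P2 : 'rV[R]_n -> R) (V' : wcomplex R n) (mu : set 'rV[R]_n -> nat),
    [/\ tropical_polynomial P1 /\ tropical_polynomial P2,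
        same_cycle d V V',
        forall s, cells V' s -> affine_on P1 s /\ affine_on P2 s,
        forall t, ridges d V' t -> exists m1 m2 : int,
          [/\ div_weight d V' P1 t m1, div_weight d V' P2 t m2
            & m1 - m2 = (mu t)%:Z]
      & same_cycle d (modified_complex d V' (fun x => P1 x - P2 x) mu) W].

Inductive modification n (d : nat) (V : wcomplex R n) :
    forall m, wcomplex R m -> Prop :=
| modification_id (W : wcomplex R n) : same_cycle d V W -> modification d V W
| modification_step m (W : wcomplex R m) (W' : wcomplex R m.+1) :
    modification d V W -> elementary_modification d W W' -> modification d V W'.

(* The projection of a modification forgets the last coordinates. *)
Definition tproj n m (nm : (n <= m)%N) (x : tspace R m) : tspace R n :=
  fun i => x (widen_ord nm i).

End Modifications.

Section HopfData.
Variable R : realType.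

Definition linear_monomial n (F : tspace R n -> tspace R n) :=
  exists (s : {perm 'I_n}) (a : 'I_n -> R),
    forall x i, F x i = tmul (x (s i)) (tfin (a (s i))).

(* The neighbourhoods are open ones: with closed neighbourhoods allowed, the
   identity would be contracting. *)
Definition contracting n (F : tspace R n -> tspace R n) :=
  forall U : set (tspace R n), open U -> U (tpoint_inf R n) ->
    exists V : set (tspace R n), [/\ open V, V (tpoint_inf R n), V `<=` U
      & closure (F @` V) `<=` V].

(* The germ at infinity of a tropical subvariety of T^n of empty sedentarity,
   the closure of [gcomplex], cut out by a neighbourhood of infinity. *)
Record germ n := Germ {
  gdim : nat;
  gcomplex : wcomplex R n;
  gnbhd : set (tspace R n) }.

Definition gset n (X : germ n) : set (tspace R n) :=
  tclosure (gcomplex X) `&` gnbhd X.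

Definition nonsingular_germ (K : fieldType) (v : K -> trop R) n (X : germ n) :=
  [/\ tropical_subvariety (gdim X) (gcomplex X),
      nbhs (tpoint_inf R n) (gnbhd X)
    & nonsingular_in v (gdim X) (gcomplex X) (gnbhd X)].

Definition affine_germ d : germ d := Germ d (full_complex R d) setT.

Definition hopf_data (K : fieldType) (v : K -> trop R) n (X : germ n)
    (F : tspace R n -> tspace R n) :=
  [/\ nonsingular_germ v X,
      modification (gdim X) (full_complex R (gdim X)) (gcomplex X),
      linear_monomial F, contracting F
    & F @` gset X `<=` gset X].

Definition translation d (a : 'I_d -> R) (x : tspace R d) : tspace R d :=
  fun i => tmul (x i) (tfin (a i)).

(* The projection is only required to map the germ into the germ: it is onto a
   neighbourhood of infinity, not onto the chosen representative. *)
Definition hopf_modification n (X : germ n) (F : tspace R n -> tspace R n)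
    n' (X' : germ n') (F' : tspace R n' -> tspace R n') :=
  [/\ gdim X' = gdim X, modification (gdim X) (gcomplex X) (gcomplex X')
    & exists nn' : (n <= n')%N,
        tproj nn' @` gset X' `<=` gset X /\
        forall x, gset X' x -> tproj nn' (F' x) = F (tproj nn' x)].

Definition cone n (V : set (tspace R n)) :=
  exists2 w : 'I_n -> R, (forall i, 0 < w i) &
    forall p (l : trop R), V p ->
      V (fun i => tmul (p i) (if l is Some c then tfin (c * w i) else tinf R)).

Definition tropical_automorphism n (d : nat) (V : wcomplex R n)
    (F : tspace R n -> tspace R n) :=
  set_bij (tclosure V) (tclosure V) F /\
  exists2 f : 'rV[R]_n -> 'rV[R]_n, (forall x, F (temb x) = temb (f x)) &
    same_cycle d (map_complex f V) V.

End HopfData.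

Section HopfManifold.
Variable R : realType.
Variable n : nat.
Variable X : set (tspace R n).
Variable F : tspace R n -> tspace R n.

Definition punctured : set (tspace R n) := X `\ tpoint_inf R n.

Definition hopf_rel (x y : set_type punctured) : bool :=
  `[< exists j k, iter j F (val x) = iter k F (val y) >].

Lemma hopf_rel_refl : reflexive hopf_rel.
Proof. by move=> x; apply/asboolP; exists 0%N, 0%N. Qed.

Lemma hopf_rel_sym : symmetric hopf_rel.
Proof.
by move=> x y; apply/asboolP/asboolP => -[j [k jk]]; exists k, j.
Qed.

Lemma hopf_rel_trans : transitive hopf_rel.
Proof.
move=> y x z /asboolP[j [k jk]] /asboolP[p [q pq]]; apply/asboolP.
by exists (p + j)%N, (k + q)%N; rewrite iterD jk -iterD addnC iterD pq -iterD.
Qed.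

Canonical hopf_equiv := EquivRel hopf_rel hopf_rel_refl hopf_rel_sym hopf_rel_trans.

(* The tropical Hopf manifold S(X, F), with the quotient topology. *)
Definition hopf_manifold := quotient_topology {eq_quot hopf_equiv}.
HB.instance Definition _ :=
  Topological.copy hopf_manifold (quotient_topology {eq_quot hopf_equiv}).

Definition hopf_pi (x : set_type punctured) : hopf_manifold := \pi_{eq_quot hopf_equiv} x.

(* The tropical Laurent monomial c + sum m_i x_i on T^n; coordinates with
   exponent 0 are ignored, even when infinite. *)
Definition laurent_monomial (c : R) (m : 'I_n -> int) (x : tspace R n) : trop R :=
  if [exists i, (m i != 0) && (x i == None :> option R)] then tinf R
  else tfin (c + \sum_(i < n) tval (x i) *~ m i).

(* The tropical structure of S(X, F) is the sheaf of functions that, on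
   [punctured], are locally integral affine, i.e. given by a Laurent monomial
   regular at the point. *)
Definition affine_at (h : hopf_manifold -> trop R) (s : hopf_manifold) :=
  forall x, hopf_pi x = s ->
    exists (c : R) (m : 'I_n -> int),
      (forall i, val x i = tinf R -> 0 <= m i) /\
      \forall y \near x, h (hopf_pi y) = laurent_monomial c m (val y).

End HopfManifold.

Definition tropical_morphism (R : realType)
    n (X : set (tspace R n)) (F : tspace R n -> tspace R n)
    n' (X' : set (tspace R n')) (F' : tspace R n' -> tspace R n')
    (f : hopf_manifold X F -> hopf_manifold X' F') :=
  continuous f /\
  forall (h : hopf_manifold X' F' -> trop R) s,
    affine_at h (f s) -> affine_at (h \o f) s.

(* S(X', F') is the quotient of S(X, F) by a finite group of tropical
   automorphisms, as a topological space and for the sheaf of affine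
   functions. *)
Definition finite_quotient (R : realType)
    n (X : set (tspace R n)) (F : tspace R n -> tspace R n)
    n' (X' : set (tspace R n')) (F' : tspace R n' -> tspace R n') :=
  exists (gT : finGroupType) (act : {action gT &-> hopf_manifold X F})
      (q : hopf_manifold X F -> hopf_manifold X' F'),
    [/\ forall g, tropical_morphism (fun s => act s g),
        forall s', exists s, q s = s',
        forall s t, q s = q t <-> exists g, t = act s g,
        forall A : set (hopf_manifold X' F'), open A <-> open (q @^-1` A)
      & forall (h : hopf_manifold X' F' -> trop R) s,
          affine_at h (q s) <-> affine_at (h \o q) s].

(* Main.v *)
Require Import Defs.
From HB Require Import structures.
From mathcomp Require Import all_boot all_order all_algebra all_fingroup.
From mathcomp Require Import all_classical all_reals all_analysis.
From mathcomp Require Import ring lra.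
Set Implicit Arguments.
Unset Strict Implicit.
Unset Printing Implicit Defensive.
Import Order.TTheory GRing.Theory Num.Theory.
Import numFieldNormedType.Exports.
Local Open Scope classical_set_scope.
Local Open Scope ring_scope.

(** A power of the contraction [F] permutes no coordinates; it is the translation by
    a vector [a], whose entries are positive because [F] is contracting
    ([contracting_gt0]). Close to infinity the germ is therefore stable under
    [x |-> x + a].

    To build the cone, replace each cell [P] of the complex by the set [asym a P] of
    the points that end up in [P] when moved in the direction [a]. The nonempty ones
    among these sets are the polyhedra [P + R a] for the cells [P] that recede in the
    direction [a]. They form a polyhedral complex in which dimensions, directions and
    incidences are those of the cells they come from ([asym_polyhedral],
    [facets_at_asym], [asym_span]), so it is balanced as well ([asym_balanced]), and
    its support is invariant under the translations by [R a].

    The new complex agrees with the germ close to infinity. A point [x] of the germ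
    has all its translates [x + k a] in the germ, hence infinitely many of them in
    the same cell, hence is in the new support ([support_asym_nat]). In particular
    the facets that come close to infinity contain the direction [a] ([facet_dir]).
    Conversely, a line of direction [a] in general position meets only facets and
    ridges. At a ridge that it crosses transversally, the adjacent facets all span
    the ridge and [a], and balancing does not allow all of them to lie on one side
    ([cross_ridge]). So the line, followed backwards from far away, does not leave
    the germ as long as it stays close to infinity ([asym_support_local]).

    The germ is non-singular, so all weights are 1: a stable intersection has
    multiplicity 1 at a point only if the facets through it that contribute have
    weight 1 ([weight_degree1]). The map [F] commutes with its power, so it preserves
    the cone, and its inverse is a power of [F] composed with a translation by
    [- a].

    Finally, the germ with the translation [F^N] instead of [F] is a modification of
    [T^d] with a translation, since the projection forgets coordinates and
    translations are coordinatewise; and [S(X, F)] is the quotient of [S(X, F^N)] by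
    a cyclic group of order [N] whose generator acts as [F]
    ([finite_quotient_iter]). *)

(** * The topology of tropical affine space *)

(** The basic neighbourhoods of a tropical number, indexed by [e > 0]: the
    interval of radius [e] around a finite number and [(1/e, oo]] around [oo].
    One parameter serves for all points, so that boxes in [T^n] have one too. *)
Definition tnear (R : realType) (e : R) (x y : trop R) : Prop :=
  match x, y with
  | Some r, Some s => `|s - r| < e
  | None, Some s => e^-1 < s
  | Some _, None => False
  | None, None => True
  end.

Lemma tnear_le (R : realType) (e f : R) (x y : trop R) :
  0 < e -> e <= f -> tnear e x y -> tnear f x y.
Proof.
case: x y => [r|] [s|] //= e0 ef; first by move=> /lt_le_trans; apply.
by apply: le_lt_trans; rewrite lef_pV2 ?posrE // (lt_le_trans e0).
Qed.

Lemma trop_ereal_inj (R : realType) : injective (@trop_ereal R).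
Proof. by move=> [r|] [s|] //= [->]. Qed.

Lemma trop_nbhsP (R : realType) (x : trop R) (A : set (trop R)) :
  nbhs x A <-> exists2 e : R, 0 < e & tnear e x `<=` A.
Proof.
split.
  rewrite nbhsE => -[B [[C Copen <-] Cx] BA].
  have : nbhs (trop_ereal x) C by apply: open_nbhs_nbhs.
  case: x Cx => [r|] /= Cx.
    move=> rC; have /nbhs_ballP[e e0 eC] : nbhs r (fun s => C s%:E) := rC.
    exists e => // -[s|] //= sr.
    by apply/BA/eC; rewrite -ball_normE /ball_ /= distrC.
  move=> [M [Mr MC]]; exists (Num.max M 1)^-1.
    by rewrite invr_gt0 lt_max ltr01 orbT.
  rewrite /tnear invrK => -[s|] /= h; last by apply/BA/MC; rewrite ltry.
  by apply/BA/MC; rewrite lte_fin (le_lt_trans _ h) // le_max lexx.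
move=> [e e0 eA].
suff xe : nbhs (trop_ereal x) (@trop_ereal R @` tnear e x).
  have : nbhs x (@trop_ereal R @^-1` (@trop_ereal R @` tnear e x)) :=
    @initial_continuous _ _ (@trop_ereal R) x _ xe.
  by apply: filterS => y [z xz] /trop_ereal_inj <-; apply: eA.
case: x {eA} => [r|] /=.
  have : nbhs r (fun s : R => (@trop_ereal R @` tnear e (Some r)) s%:E).
    apply/nbhs_ballP; exists e => // s; rewrite -ball_normE /ball_ /= distrC => rs.
    by exists (Some s).
  by [].
exists e^-1; split; first exact: num_real.
move=> [s| |] //= es; last by exists None.
by exists (Some s) => //=; rewrite -lte_fin.
Qed.

Definition tbox (R : realType) n (e : R) (p q : tspace R n) : Prop :=
  forall i, tnear e (p i) (q i).

Lemma tbox_le (R : realType) n (e f : R) (p q : tspace R n) :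
  0 < e -> e <= f -> tbox e p q -> tbox f p q.
Proof. by move=> e0 ef pq i; apply: tnear_le (pq i). Qed.

Lemma tproj_nbhs (R : realType) n (p : tspace R n) (i : 'I_n) (A : set (trop R)) :
  nbhs (p i) A -> nbhs p [set q | A (q i)].
Proof. exact: (@proj_continuous _ (fun _ : 'I_n => trop R) i p). Qed.

(** Boxes form a basis of neighbourhoods: the filter they generate converges to
    [p] coordinatewise, hence for the product topology. *)
Lemma tspace_nbhsP (R : realType) n (p : tspace R n) (A : set (tspace R n)) :
  nbhs p A <-> exists2 e : R, 0 < e & tbox e p `<=` A.
Proof.
split=> [pA|[e e0 eA]].
  pose F := filter_from [set e : R | 0 < e] (fun e => [set q : tspace R n | tbox e p q]).
  have FF : Filter F.
    apply: filter_from_filter; first by exists 1 => /=.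
    move=> e f /= e0 f0; exists (Num.min e f); first by rewrite /= lt_min e0.
    by move=> q pq; split; apply: tbox_le pq; rewrite ?lt_min ?e0 ?ge_min ?lexx ?orbT.
  suff Fp : F --> p by have [e e0 ?] := Fp _ pA; exists e.
  apply/(@cvg_sup _ _ (fun i => Topological.class
    (initial_topology (fun f : 'I_n -> trop R => f i)))) => i B.
  rewrite (@nbhsE (initial_topology (fun f : 'I_n -> trop R => f i))).
  move=> -[_ [[C Copen <-] Cp] CB].
  have /trop_nbhsP[e e0 eC] : nbhs (p i) C by apply: open_nbhs_nbhs.
  by exists e => // q pq; apply/CB/eC/pq.
apply: filterS eA _.
apply: (@filter_forall _ _ (fun i q => tnear e (p i) (q i)) (nbhs p)) => i.
by apply/tproj_nbhs/trop_nbhsP; exists e.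
Qed.

Lemma tclosureP (R : realType) n (A : set (tspace R n)) p :
  closure A p <-> forall e : R, 0 < e -> exists2 q, A q & tbox e p q.
Proof.
split=> [pA e e0|pA B /tspace_nbhsP[e e0 eB]].
  have [|q [Aq pq]] := pA [set q | tbox e p q]; first by apply/tspace_nbhsP; exists e.
  by exists q.
by have [q Aq pq] := pA e e0; exists q; split=> //; apply: eB.
Qed.

Definition far (R : realType) n (M : R) : set (tspace R n) :=
  [set x | forall i, if x i is Some s then M < s else true].

Lemma nbhs_infP (R : realType) n (A : set (tspace R n)) :
  nbhs (tpoint_inf R n) A <-> exists M : R, far M `<=` A.
Proof.
rewrite tspace_nbhsP; split=> [[e e0 eA]|[M MA]].
  by exists e^-1 => x xM; apply: eA => i; have := xM i; case: (x i).
have M0 : 0 < Num.max M 1 by rewrite lt_max ltr01 orbT.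
exists (Num.max M 1)^-1; first by rewrite invr_gt0.
move=> x xM; apply: MA => i; have := xM i; case: (x i) => //= s.
by rewrite invrK; apply: le_lt_trans; rewrite le_max lexx.
Qed.

Lemma far_inf (R : realType) n (M : R) : far M (tpoint_inf R n).
Proof. by []. Qed.

(** The coordinates being finitely many, one size of box serves for all. *)
Lemma far_box (R : realType) n (M : R) (p : tspace R n) :
  far M p -> exists2 e : R, 0 < e & tbox e p `<=` far M.
Proof.
move=> pM.
have [e e0 He] : exists2 e : R, 0 < e & forall i, i \in enum 'I_n ->
    if p i is Some s then M < s - e else M < e^-1.
  elim: (enum 'I_n) => [|i l [e e0 IH]]; first by exists 1.
  have [f f0 Hf] : exists2 f : R, 0 < f & if p i is Some s then M < s - f else M < f^-1.
    have := pM i; case: (p i) => [s|] sM; first by exists ((s - M) / 2); lra.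
    have M0 : 0 < Num.max M 0 + 1 by rewrite ltr_wpDl // le_max lexx orbT.
    exists (Num.max M 0 + 1)^-1; rewrite ?invr_gt0 // invrK.
    by rewrite (@le_lt_trans _ _ (Num.max M 0)) ?le_max ?lexx // ltrDl.
  have m0 : 0 < Num.min e f by rewrite lt_min e0.
  exists (Num.min e f) => // j; rewrite inE => /orP[/eqP->|/IH].
    case: (p i) Hf => [s|] h.
      by apply: (lt_le_trans h); rewrite lerD2l lerN2 ge_min lexx orbT.
    by apply: (lt_le_trans h); rewrite lef_pV2 ?posrE // ge_min lexx orbT.
  case: (p j) => [s|] h.
    by apply: (lt_le_trans h); rewrite lerD2l lerN2 ge_min lexx.
  by apply: (lt_le_trans h); rewrite lef_pV2 ?posrE // ge_min lexx.
exists e => // q pq i; have := pq i; have := He i; rewrite mem_enum => /(_ isT).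
case: (p i) => [s|]; case: (q i) => [t|] //= h1; last exact: lt_trans.
by rewrite ltr_norml => /andP[h2 _]; lra.
Qed.

Lemma open_far (R : realType) n (M : R) : open (@far R n M).
Proof. by rewrite openE => p /far_box h; apply/tspace_nbhsP. Qed.

Lemma tbox_temb (R : realType) n (e : R) (x : 'rV[R]_n) (q : tspace R n) :
  tbox e (temb x) q ->
  exists2 y : 'rV[R]_n, q = temb y & forall i, `|y 0 i - x 0 i| < e.
Proof.
move=> xq; exists (\row_i Defs.tval (q i)).
  by apply/funext => i; have := xq i; rewrite /temb mxE; case: (q i).
by move=> i; have := xq i; rewrite mxE /temb /=; case: (q i).
Qed.

Lemma temb_inj (R : realType) n : injective (@temb R n).
Proof.
move=> x y xy; apply/rowP => i.
by have := congr1 (fun p : tspace R n => p i) xy => -[].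
Qed.

(** Infinite coordinates are limits of large finite ones. *)
Lemma dense_temb (R : realType) n (p : tspace R n) :
  closure (@temb R n @` setT) p.
Proof.
apply/tclosureP => e e0.
exists (temb (\row_i (if p i is Some s then s else e^-1 + 1))); first by eexists.
move=> i; rewrite /temb mxE; case: (p i) => [s|] /=; last by rewrite ltrDl.
by rewrite subrr normr0.
Qed.

Lemma closureI_open (T : topologicalType) (A O : set T) p :
  open O -> O p -> closure A p -> closure (A `&` O) p.
Proof.
move=> Oo Op Ap B pB.
have [|q [Aq [Oq Bq]]] := Ap (O `&` B); last by exists q.
by apply: filterI => //; apply: open_nbhs_nbhs.
Qed.

(** A translation by [c] maps the neighbourhood [(L, oo]] of [oo] to
    [(L + c, oo]]; hence the size [1 / (1 / e + M)]. *)
Lemma tmul_near (R : realType) (e M c : R) (x y : trop R) :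
  0 < e -> `|c| <= M -> tnear (e^-1 + M)^-1 x y ->
  tnear e (tmul x (tfin c)) (tmul y (tfin c)).
Proof.
move=> e0 cM; have M0 : 0 <= M by apply: le_trans cM.
have i0 : 0 < e^-1 by rewrite invr_gt0.
case: x y => [r|] [s|] //=.
  rewrite opprD addrACA subrr addr0 => /lt_le_trans; apply.
  by rewrite -[leRHS]invrK lef_pV2 ?posrE ?lerDl // ltr_wpDr.
by rewrite invrK => h; have := ler_norm (- c); rewrite normrN; lra.
Qed.

(** * Linear spans, dimension and generic points of polyhedra *)

Section LinearSpan.
Variables (R : realType) (n : nat).
Implicit Types (P Q L O : set 'rV[R]_n) (u v w x y z a : 'rV[R]_n).

Lemma dotD a x y : dot a (x + y) = dot a x + dot a y.
Proof. by rewrite /dot -big_split; apply: eq_bigr => i _; rewrite mxE mulrDr. Qed.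

Lemma dotZ a c x : dot a (c *: x) = c * dot a x.
Proof.
by rewrite /dot mulr_sumr; apply: eq_bigr => i _; rewrite mxE mulrCA.
Qed.

Lemma dotN a x : dot a (- x) = - dot a x.
Proof. by rewrite -scaleN1r dotZ mulN1r. Qed.

Definition dotE := (dotD, dotZ, dotN).

Definition subspace L := L 0 /\ forall (c : R) u w, L u -> L w -> L (c *: u + w).

Lemma subspaceZ L c u : subspace L -> L u -> L (c *: u).
Proof. by move=> [L0 LD] Lu; rewrite -[_ *: _]addr0; apply: LD. Qed.

Lemma subspaceN L u : subspace L -> L u -> L (- u).
Proof. by move=> LL Lu; rewrite -scaleN1r; apply: subspaceZ. Qed.

Lemma subspaceD L u w : subspace L -> L u -> L w -> L (u + w).
Proof. by move=> [_ LD] Lu Lw; rewrite -[u]scale1r; apply: LD. Qed.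

Lemma subspaceB L u w : subspace L -> L u -> L w -> L (u - w).
Proof. by move=> LL Lu Lw; apply: subspaceD => //; apply: subspaceN. Qed.

Lemma subspace_sum (I : Type) (r : seq I) (f : I -> 'rV[R]_n) L :
  subspace L -> (forall i, L (f i)) -> L (\sum_(i <- r) f i).
Proof.
move=> LL Lf; elim: r => [|i r IH]; first by rewrite big_nil; case: LL.
by rewrite big_cons; apply: subspaceD.
Qed.

Lemma subspace_mx m (A : 'M[R]_(m, n)) : subspace [set v | (v <= A)%MS].
Proof.
split=> [|c u w uA wA] /=; first exact: sub0mx.
by apply: addmx_sub => //; apply: scalemx_sub.
Qed.

(** The maximal families of differences counted by [pdim] are bases of the
    linear span: adding a difference outside of the span of a free family would
    give a larger free family. *)
Lemma lin_span_basis P :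
  exists A : 'M[R]_(pdim P, n), row_free A /\ lin_span P = [set v | (v <= A)%MS].
Proof.
pose Pr (r : 'I_n.+1) := `[< exists M : 'M[R]_(r, n), row_free M /\
      forall i, exists x y, [/\ P x, P y & row i M = x - y] >].
have Pr0 : Pr ord0.
  apply/asboolP; exists 0; split; last by case.
  by rewrite /row_free mxrank0.
have Pr_gt0 : (0 < #|[pred r | Pr r]|)%N by apply/card_gt0P; exists ord0.
have [r /asboolP[M [Mfree Mrows]] dimr] :=
  eq_bigmax_cond (fun r : 'I_n.+1 => nat_of_ord r) Pr_gt0.
have -> : pdim P = r by rewrite -dimr.
exists M; split => //; apply/seteqP; split => v /=; last by exists r, M.
move=> [m [N [Nrows vN]]]; apply: submx_trans vN _; apply/row_subP => i.
have [//|niM] := boolP (row i N <= M)%MS.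
have lt_r : (\rank M < \rank (col_mx (row i N) M))%N.
  rewrite -addsmxE; apply: rank_ltmx; rewrite ltmxE addsmxSr /=.
  by apply: contra niM => /(submx_trans _)-> //; apply: addsmxSl.
have free : row_free (col_mx (row i N) M).
  by rewrite (eqP Mfree) in lt_r; rewrite /row_free eqn_leq rank_leq_row.
have rn : (r.+1 < n.+1)%N.
  by have := rank_leq_col (col_mx (row i N) M); rewrite (eqP free) add1n.
have rows (j : 'I_(1 + r)) :
    exists x y, [/\ P x, P y & row j (col_mx (row i N) M) = x - y].
  case: (split_ordP j) => k ->; last by rewrite rowKd; apply: Mrows.
  by rewrite rowKu row_id; apply: Nrows.
have Pr1 : Ordinal rn \in [pred r | Pr r].
  by apply/asboolP; exists (col_mx (row i N) M).
have := leq_bigmax_cond (F := fun r : 'I_n.+1 => nat_of_ord r) _ Pr1.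
by rewrite dimr ltnn.
Qed.

Lemma subspace_lin_span P : subspace (lin_span P).
Proof. by have [A [_ ->]] := lin_span_basis P; apply: subspace_mx. Qed.
Hint Resolve subspace_lin_span : core.

Lemma lin_span_sub P x y : P x -> P y -> lin_span P (x - y).
Proof.
move=> Px Py; exists 1%N, (x - y); split=> // i; exists x, y; split=> //.
by rewrite row_id.
Qed.

Lemma lin_span_min P L :
  subspace L -> (forall x y, P x -> P y -> L (x - y)) -> lin_span P `<=` L.
Proof.
move=> LL PL v [r [M [Mrows /submxP[D ->]]]]; rewrite mulmx_sum_row.
apply: subspace_sum => // i; apply: subspaceZ => //.
by have [x [y [Px Py ->]]] := Mrows i; apply: PL.
Qed.

Lemma lin_spanS P Q : P `<=` Q -> lin_span P `<=` lin_span Q.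
Proof. by move=> PQ; apply: lin_span_min => // x y /PQ ? /PQ ?; apply: lin_span_sub. Qed.

Lemma lin_span_mxS P Q (A : 'M[R]_(pdim P, n)) (B : 'M[R]_(pdim Q, n)) :
  lin_span P = [set v | (v <= A)%MS] -> lin_span Q = [set v | (v <= B)%MS] ->
  lin_span P `<=` lin_span Q <-> (A <= B)%MS.
Proof.
move=> -> ->; split=> [AB|AB v /= vA]; last exact: submx_trans AB.
by apply/row_subP => i; apply: (AB (row i A)) => /=; apply: row_sub.
Qed.

Lemma pdimS P Q : lin_span P `<=` lin_span Q -> (pdim P <= pdim Q)%N.
Proof.
have [A [Af EA]] := lin_span_basis P; have [B [Bf EB]] := lin_span_basis Q.
by move=> /(lin_span_mxS EA EB)/mxrankS; rewrite (eqP Af) (eqP Bf).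
Qed.

Lemma lin_span_eq P Q : lin_span P `<=` lin_span Q -> (pdim Q <= pdim P)%N ->
  lin_span P = lin_span Q.
Proof.
have [A [Af EA]] := lin_span_basis P; have [B [Bf EB]] := lin_span_basis Q.
move=> /[dup] PQ /(lin_span_mxS EA EB) AB dQP; apply/seteqP; split=> //.
apply/(lin_span_mxS EB EA); rewrite -(geq_leqif (mxrank_leqif_sup AB)).
by rewrite (eqP Af) (eqP Bf).
Qed.

(** A count of dimensions: the sum of [lin_span t] and [R a] has one dimension more
    than [lin_span t], contains [lin_span P] and lies in [lin_span s]; since
    these two have the same dimension, all three coincide. *)
Lemma pdim_line P t s a :
  lin_span t `<=` lin_span s -> lin_span s a -> ~ lin_span t a ->
  (forall v, lin_span P v -> exists k, lin_span t (v - k *: a)) ->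
  pdim P = pdim s ->
  (pdim t).+1 = pdim s /\
  forall v, lin_span s v -> exists k, lin_span t (v - k *: a).
Proof.
move=> ts sa nta Pta dPs.
have [A [Af EA]] := lin_span_basis P; have [B [Bf EB]] := lin_span_basis s.
have [T [Tf ET]] := lin_span_basis t.
have TB : (T <= B)%MS by apply/(lin_span_mxS ET EB).
have Ta_s : (T + a <= B)%MS by rewrite addsmx_sub TB; move: sa; rewrite EB.
have A_Ta : (A <= T + a)%MS.
  apply/row_subP => i; have [|k] := Pta (row i A); first by rewrite EA /= row_sub.
  rewrite ET /= => h; rewrite -[row i A](subrK (k *: a)); apply: addmx_sub.
    by apply: submx_trans h _; apply: addsmxSl.
  by apply: scalemx_sub; apply: addsmxSr.
have AB : (A <= B)%MS := submx_trans A_Ta Ta_s.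
have sTa : (B <= T + a)%MS.
  apply: submx_trans A_Ta; rewrite -(geq_leqif (mxrank_leqif_sup AB)).
  by rewrite (eqP Af) (eqP Bf) dPs.
split.
  have le1 : (\rank B <= \rank T + 1)%N.
    apply: leq_trans (mxrankS sTa) _; apply: leq_trans (mxrank_adds_leqif _ _) _.
    by rewrite leq_add2l rank_leq_row.
  have lt1 : (\rank T < \rank B)%N.
    apply: rank_ltmx; rewrite ltmxE TB /=; apply/negP => BT; apply: nta.
    by rewrite ET /=; apply: submx_trans BT; move: sa; rewrite EB.
  by apply/eqP; rewrite eqn_leq -(eqP Tf) -(eqP Bf) lt1 -addn1.
move=> v; rewrite EB /= => /submx_trans/(_ sTa)/sub_addsmxP[[u1 u2] /= ->].
exists (u2 0 0); rewrite ET /= [u2]mx11_scalar mul_scalar_mx !mxE eqxx mulr1n addrK.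
exact: submxMl.
Qed.

(** Openness along lines suffices to bring points into general position, and it
    calls for no norm on [R^n]. *)
Definition line_open O := forall x v, O x ->
  exists2 e : R, 0 < e & forall t, `|t| < e -> O (x + t *: v).

Lemma finite_small (T : eqType) (l : seq T) (A : T -> R -> Prop) :
  (forall i, i \in l -> exists2 e : R, 0 < e & forall t, `|t| < e -> A i t) ->
  exists2 e : R, 0 < e & forall t, `|t| < e -> forall i, i \in l -> A i t.
Proof.
elim: l => [|j l IH] lA; first by exists 1.
have [|e e0 He] := IH; first by move=> i il; apply: lA; rewrite inE il orbT.
have [|f f0 Hf] := lA j; first by rewrite inE eqxx.
exists (Num.min e f) => [|t]; first by rewrite lt_min e0.
by rewrite lt_min => /andP[/He te /Hf tf] i; rewrite inE => /orP[/eqP->|/te].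
Qed.

Lemma line_openI O L : line_open O -> line_open L -> line_open (O `&` L).
Proof.
move=> oO oL x v [/(oO x v)[e e0 He] /(oL x v)[f f0 Hf]].
exists (Num.min e f) => [|t]; first by rewrite lt_min e0.
by rewrite lt_min => /andP[/He te /Hf tf].
Qed.

Lemma line_open_affine L p : subspace L -> line_open [set x | ~ L (x - p)].
Proof.
move=> LL x v /= nx; have [Lv|nLv] := pselect (L v).
  exists 1 => // t _ h; apply: nx.
  have -> : x - p = (x + t *: v - p) - t *: v by rewrite [x + _ - p]addrAC addrK.
  by apply: subspaceB => //; apply: subspaceZ.
have [[t [t0 Lt]]|none] := pselect (exists t, t != 0 /\ L (x + t *: v - p)); last first.
  exists 1 => // t _ h; have [t0|t0] := eqVneq t 0; last by apply: none; exists t.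
  by apply: nx; move: h; rewrite t0 scale0r addr0.
exists `|t| => [|s st h]; first by rewrite normr_gt0.
apply: nLv; have ts : t - s != 0.
  by apply: contraTneq st => /subr0_eq ->; rewrite ltxx.
have -> : v = (t - s)^-1 *: ((x + t *: v - p) - (x + s *: v - p)).
  rewrite opprB addrA subrK opprD addrACA subrr add0r -scalerBl.
  by rewrite scalerA mulVf // scale1r.
by apply: subspaceZ => //; apply: subspaceB.
Qed.

Definition convex_set P := forall x y, P x -> P y ->
  forall t : R, 0 <= t <= 1 -> P (x + t *: (y - x)).

(** A point is moved out of one affine subspace at a time, towards a point of [P]
    that the subspace does not contain; short steps stay off the previous
    subspaces, whose complements are line-open. *)
Lemma general_position P (T : eqType) (l : seq T) (p : T -> 'rV[R]_n)
    (L : T -> set 'rV[R]_n) O z :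
  convex_set P -> line_open O -> P z -> O z ->
  (forall i, i \in l -> subspace (L i) /\ ~ (lin_span P `<=` L i)) ->
  exists y, [/\ P y, O y & forall i, i \in l -> ~ L i (y - p i)].
Proof.
move=> cP; elim: l O z => [|j l IH] O z oO Pz Oz lL; first by exists z.
have [Lj nPj] : subspace (L j) /\ ~ (lin_span P `<=` L j).
  by apply: lL; rewrite inE eqxx.
suff [y [Py Oy nLy]] : exists y, [/\ P y, O y & ~ L j (y - p j)].
  have [||//|i il|x [Px [Ox xj] xl]] := IH (O `&` [set x | ~ L j (x - p j)]) y => //.
  - by apply: line_openI => //; apply: line_open_affine.
  - by apply: lL; rewrite inE il orbT.
  by exists x; split=> // i; rewrite inE => /orP[/eqP->//|/xl].
have [zj|nzj] := pselect (L j (z - p j)); last by exists z.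
have [y Py nzy] : exists2 y, P y & ~ L j (y - z).
  apply: contrapT => none; apply: nPj; apply: lin_span_min => // x y Px Py.
  have -> : x - y = (x - z) - (y - z) by rewrite opprB addrA subrK.
  by apply: subspaceB => //; apply: contrapT => h; apply: none; [exists x|exists y].
have [e e0 He] := oO z (y - z) Oz.
have m0 : 0 < Num.min (e / 2) 1 by rewrite lt_min ltr01 divr_gt0.
have m1 : `|Num.min (e / 2) 1| < e.
  by rewrite gtr0_norm // gt_min; apply/orP; left; lra.
exists (z + Num.min (e / 2) 1 *: (y - z)); split; first 1 last.
- exact: He.
- move=> h; apply: nzy.
  have -> : y - z = (Num.min (e / 2) 1)^-1 *:
      ((z + Num.min (e / 2) 1 *: (y - z) - p j) - (z - p j)).
    rewrite opprB addrA subrK addrAC subrr add0r scalerA mulVf ?scale1r //.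
    by rewrite gt_eqF.
  by apply: subspaceZ => //; apply: subspaceB.
by apply: cP => //; rewrite (ltW m0) ge_min lexx orbT.
Qed.

End LinearSpan.
#[export] Hint Resolve subspace_lin_span : core.

(** * Rational polyhedra and their faces *)

Section Polyhedra.
Variables (R : realType) (n : nat).
Implicit Types (P Q F L : set 'rV[R]_n) (u v w x y z a : 'rV[R]_n).
Implicit Types (l : seq ('rV[int]_n * R)).

Definition halfspaces l : set 'rV[R]_n :=
  [set x | forall h, h \in l -> h.2 <= dot (zvec R h.1) x].

Lemma convex_rational P : rational_polyhedron P -> convex_set P.
Proof.
move=> [l ->] x y xl yl t /andP[t0 t1] h hl.
rewrite scalerBr !dotE; have := xl h hl; have := yl h hl.
set p := dot _ x; set q := dot _ y; set b := h.2 => qb pb.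
have := mulr_ge0 t0 (_ : 0 <= q - b); have := mulr_ge0 (_ : 0 <= 1 - t) (_ : 0 <= p - b).
by rewrite !subr_ge0 => /(_ t1 pb) ? /(_ qb) ?; lra.
Qed.

Lemma dot_small (b : R) a x v : b < dot a x ->
  exists2 e : R, 0 < e & forall t, `|t| < e -> b < dot a (x + t *: v).
Proof.
move=> bx; pose m := `|dot a v| + 1.
have m0 : 0 < m by rewrite ltr_wpDl.
exists ((dot a x - b) / m) => [|t]; first by rewrite divr_gt0 // subr_gt0.
rewrite ltr_pdivlMr // !dotE => tm.
have : `|t * dot a v| <= `|t| * m by rewrite normrM ler_wpM2l // lerDl.
by rewrite ler_norml => /andP[h _]; lra.
Qed.

Lemma line_open_setC P : rational_polyhedron P -> line_open (~` P).
Proof.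
move=> [l ->] x v /= nx.
have [h hl hx] : exists2 h, h \in l & dot (zvec R h.1) x < h.2.
  apply: contrapT => none; apply: nx => h hl; rewrite leNgt; apply/negP => hx.
  by apply: none; exists h.
have [|e e0 He] := @dot_small (- h.2) (- zvec R h.1) x v.
  have -> : dot (- zvec R h.1) x = - dot (zvec R h.1) x.
    by rewrite /dot -sumrN; apply: eq_bigr => i _; rewrite mxE mulNr.
  by rewrite ltrN2.
exists e => // t /He; rewrite /dot => te /(_ h hl); apply/negP; rewrite -ltNge.
rewrite -ltrN2 (lt_le_trans te) // -sumrN ler_sum // => i _.
by rewrite mxE mulNr.
Qed.

Lemma relint_line P x v : convex_set P -> relint P x -> lin_span P v ->
  exists2 e : R, 0 < e & forall t, `|t| < e -> P (x + t *: v).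
Proof.
move=> cP [Px xP].
pose D := [set v | exists2 e : R, 0 < e & forall t, `|t| < e -> P (x + t *: v)].
have DD : subspace D.
  split; first by exists 1 => // t _; rewrite scaler0 addr0.
  move=> c u w [e e0 He] [f f0 Hf].
  have c0 : 0 < `|c| + 1 by rewrite ltr_wpDl.
  exists (Num.min (e / (2 * (`|c| + 1))) (f / 2)).
    by rewrite lt_min !divr_gt0 // mulr_gt0.
  move=> t; rewrite lt_min => /andP[te tf].
  have {}te : P (x + (2 * (t * c)) *: u).
    apply: He; rewrite !normrM ger0_norm //.
    move: te; rewrite ltr_pdivlMr ?mulr_gt0 // => te.
    by apply: le_lt_trans te; rewrite mulrCA ler_wpM2l // ler_wpM2l // lerDl.
  have {}tf : P (x + (2 * t) *: w).
    by apply: Hf; rewrite normrM ger0_norm // mulrC -ltr_pdivlMr.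
  have := cP _ _ te tf (2^-1); rewrite invr_ge0 ler0n invf_le1 ?ler1n // => /(_ isT).
  congr P; rewrite opprD addrACA subrr add0r; apply/rowP => i; rewrite !mxE; by field.
apply: (@lin_span_min _ _ P D) => // y y' Py Py'.
suff Dx z : P z -> D (z - x).
  have -> : y - y' = (y - x) - (y' - x) by rewrite opprB addrA subrK.
  by apply: subspaceB => //; apply: Dx.
move=> Pz; have [e e0 Pe] := xP z Pz.
have m0 : 0 < Num.min e 1 by rewrite lt_min e0 ltr01.
exists (Num.min e 1) => // t; rewrite lt_min => /andP[te t1].
have [t0|t0] := leP 0 t.
  by apply: cP => //; rewrite t0 -(ger0_norm t0) ltW.
have := cP _ _ Px Pe (- t / e); rewrite divr_ge0 ?(ltW e0) ?oppr_ge0 ?(ltW t0) //=.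
rewrite ler_pdivrMr // mul1r -(ltr0_norm t0) (ltW te) => /(_ isT).
congr P; rewrite (ltr0_norm t0) addrAC subrr add0r scalerN scalerA divfK ?gt_eqF //.
by rewrite -scaleNr opprK.
Qed.

(** The implicit equations of a polyhedron are those of its inequalities that
    are equalities throughout; a point where the others are strict is a relative
    interior point. *)
Definition strict_point l x := forall h, h \in l ->
  (forall y, halfspaces l y -> dot (zvec R h.1) y = h.2) \/ h.2 < dot (zvec R h.1) x.

Lemma strict_line l x v : halfspaces l x -> strict_point l x ->
  (forall h, h \in l -> (forall y, halfspaces l y -> dot (zvec R h.1) y = h.2) ->
     dot (zvec R h.1) v = 0) ->
  exists2 e : R, 0 < e & forall t, `|t| < e -> halfspaces l (x + t *: v).
Proof.
move=> xl sx vl; apply: finite_small => h hl.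
have [eq|/(dot_small v)[e e0 He]] := sx h hl; last first.
  by exists e => // t /He /ltW.
by exists 1 => // t _; rewrite !dotE vl // mulr0 addr0; apply: xl.
Qed.

Lemma strict_relint l x : halfspaces l x -> strict_point l x -> relint (halfspaces l) x.
Proof.
move=> xl sx; split=> // y yl.
have [h hl eq|e e0 He] := strict_line (v := y - x) xl sx.
  by rewrite !dotE !eq // subrr.
exists (e / 2); first by rewrite divr_gt0.
rewrite -scaleNr; apply: He; rewrite normrN ger0_norm; lra.
Qed.

Lemma strict_point_exists l : halfspaces l !=set0 -> exists2 x, halfspaces l x & strict_point l x.
Proof.
move=> [x0 x0l].
suff /(_ l) : forall l', {subset l' <= l} -> exists2 x, halfspaces l x &
    forall h, h \in l' -> (forall y, halfspaces l y -> dot (zvec R h.1) y = h.2) \/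
      h.2 < dot (zvec R h.1) x by apply.
elim=> [|h l' IH] sub; first by exists x0.
have [|x xl sx] := IH; first by move=> g gl; apply: sub; rewrite inE gl orbT.
have hl : h \in l by apply: sub; rewrite inE eqxx.
have [eq|neq] := pselect (forall y, halfspaces l y -> dot (zvec R h.1) y = h.2).
  by exists x => // g; rewrite inE => /orP[/eqP->|/sx //]; left.
have [y yl hy] : exists2 y, halfspaces l y & h.2 < dot (zvec R h.1) y.
  apply: contrapT => none; apply: neq => y yl; apply/eqP; rewrite eq_le yl // andbT.
  by rewrite leNgt; apply/negP => hy; apply: none; exists y.
(* Both sets of strict inequalities hold at the midpoint. *)
exists (x + 2^-1 *: (y - x)).
  apply: convex_rational => //; first by exists l.
  by rewrite invr_ge0 ler0n invf_le1 ?ler1n.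
move=> g; rewrite inE !dotE => /orP[/eqP->|gl].
  by right; have := xl h hl; lra.
have [|gx] := sx g gl; first by left.
have := yl g (sub g _); rewrite inE gl orbT => /(_ isT) gy.
by right; lra.
Qed.

Lemma relint_exists P : rational_polyhedron P -> P !=set0 -> exists x, relint P x.
Proof. by move=> [l ->] /strict_point_exists[x xl /strict_relint]; exists x; auto. Qed.

Lemma face_relint F P x : face F P -> relint P x -> F x -> F = P.
Proof.
move=> [_ [a [b [Pb ->]]]] [Px xP] [_ /= ax].
apply/seteqP; split=> [y []//|y Py]; split=> //=.
have [e e0 /Pb] := xP y Py; rewrite !dotE ax => h.
apply/eqP; rewrite eq_le Pb // andbT.
by move: h; rewrite -subr_ge0 addrAC subrr add0r oppr_ge0 pmulr_rle0 // subr_le0.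
Qed.

Lemma face_pdim F P : face F P -> (pdim P <= pdim F)%N -> F = P.
Proof.
move=> [[x Fx] [a [b [Pb EF]]]] dPF.
have FP : F `<=` P by rewrite EF => y [].
have ES : lin_span F = lin_span P by apply: lin_span_eq => //; apply: lin_spanS.
apply/seteqP; split=> // y Py; rewrite EF; split=> //=.
have [Px ax] : P x /\ dot a x = b by move: Fx; rewrite EF.
have Fyx : lin_span F (y - x) by rewrite ES; apply: lin_span_sub.
have : dot a (y - x) = 0.
  apply: (@lin_span_min _ _ F [set v | dot a v = 0]) Fyx => /=.
    split=> [|c u w au aw]; last by rewrite /= !dotE au aw mulr0 addr0.
    by rewrite /= -[0](subrr 0) !dotE subrr.
  by move=> z z'; rewrite EF => -[_ /= az] [_ /= az']; rewrite !dotE az az' subrr.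
by rewrite !dotE ax => /eqP; rewrite subr_eq0 => /eqP.
Qed.

(** Clearing denominators. *)
Lemma rat_row_int (q : 'rV[rat]_n) : exists (D : int) (z : 'rV[int]_n),
  D != 0 /\ D%:~R *: q = map_mx intr z.
Proof.
exists (\prod_j denq (q 0 j)), (\row_j (numq (q 0 j) * \prod_(k | k != j) denq (q 0 k))).
split; first by apply/prodf_neq0 => j _; apply: denq_neq0.
apply/rowP => j; rewrite !mxE (bigD1 j) //= !rmorphM /=.
rewrite -[X in _ * X = _](divq_num_den (q 0 j)) mulrAC [_%:~R * (_ / _)]mulrC.
by rewrite divfK // intr_eq0 denq_neq0.
Qed.

(** The direction of a rational polyhedron is the kernel of an integer matrix,
    that of its implicit equations; so it is spanned by integer vectors. *)
Lemma rational_span P L : rational_polyhedron P -> P !=set0 -> subspace L ->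
  (forall z : 'rV[int]_n, lin_span P (zvec R z) -> L (zvec R z)) ->
  lin_span P `<=` L.
Proof.
move=> [l ->] /strict_point_exists[x xl sx] LL Lz.
pose l0 := [seq h <- l | `[< forall y, halfspaces l y -> dot (zvec R h.1) y = h.2 >]].
pose A : 'M[int]_(n, size l0) := \matrix_(i, j) (tnth (in_tuple l0) j).1 0 i.
have AE v : v *m map_mx intr A = 0 <-> forall h, h \in l0 -> dot (zvec R h.1) v = 0.
  have AEj j : (v *m map_mx intr A) 0 j = dot (zvec R (tnth (in_tuple l0) j).1) v.
    by rewrite mxE; apply: eq_bigr => i _; rewrite !mxE mulrC.
  split=> [/rowP vA h /(tnthP (in_tuple l0))[j ->]|vA].
    by rewrite -AEj vA mxE.
  by apply/rowP => j; rewrite AEj mxE vA // (mem_tnth j (in_tuple l0)).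
have spanE v : lin_span (halfspaces l) v <-> v *m map_mx intr A = 0.
  rewrite AE; split=> [vl h|vl].
    rewrite mem_filter => /andP[/asboolP eq hl].
    apply: (@lin_span_min _ _ (halfspaces l) [set v | dot (zvec R h.1) v = 0]) vl => /=.
      split=> [|c u w au aw]; last by rewrite /= !dotE au aw mulr0 addr0.
      by rewrite /= -[0](subrr 0) !dotE subrr.
    by move=> y y' yl yl'; rewrite /= !dotE !eq // subrr.
  have [h hl eq|e e0 He] := strict_line (v := v) xl sx.
    by apply: vl; rewrite mem_filter hl andbT; apply/asboolP.
  have -> : v = (2 / e) *: ((x + (e / 2) *: v) - x).
    have -> : x + (e / 2) *: v - x = (e / 2) *: v by rewrite addrAC subrr add0r.
    rewrite scalerA (_ : 2 / e * (e / 2) = 1) ?scale1r //.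
    by field; rewrite gt_eqF.
  apply: subspaceZ => //; apply: lin_span_sub => //; apply: He.
  rewrite ger0_norm; lra.
pose Aq : 'M[rat]_(n, size l0) := map_mx intr A.
have Aqr : map_mx intr A = map_mx (@ratr R) Aq.
  by apply/matrixP => i j; rewrite !mxE ratr_int.
move=> v /spanE vA; have : (v <= kermx (map_mx (@ratr R) Aq))%MS.
  by apply/sub_kermxP; rewrite -Aqr.
rewrite -map_kermx => /submxP[D ->]; rewrite mulmx_sum_row.
apply: subspace_sum => // i; apply: subspaceZ => //.
have [c [z [c0 cz]]] := rat_row_int (row i (kermx Aq)).
have zE : zvec R z = c%:~R *: row i (map_mx (@ratr R) (kermx Aq)).
  apply/rowP => j; have := congr1 (fun q : 'rV_n => @ratr R (q 0 j)) cz.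
  by rewrite !mxE rmorphM /= !ratr_int => <-.
have -> : row i (map_mx (@ratr R) (kermx Aq)) = c%:~R^-1 *: zvec R z.
  by rewrite zE scalerA mulVf ?scale1r // intr_eq0.
apply: subspaceZ => //; apply: Lz; apply/spanE.
rewrite zE Aqr -scalemxAl; apply/eqP; rewrite scaler_eq0; apply/orP; right; apply/eqP.
by rewrite -row_mul -map_mxM mulmx_ker map_mx0 row0.
Qed.

(** * Cells of polyhedral complexes *)

Section Cells.
Variable C : wcomplex R n.
Hypothesis CC : polyhedral_complex C.

Lemma cell_rational P : cells C P -> rational_polyhedron P.
Proof. by move=> CP; have [_ h _ _] := CC; have [] := h P CP. Qed.

Lemma cell_convex P : cells C P -> convex_set P.
Proof. by move=> /cell_rational/convex_rational. Qed.

(** A point is interior to the smallest cell containing it: the inequalities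
    that are tight there cut out a face. *)
Lemma relint_cell x : Defs.support C x -> exists2 P, cells C P & relint P x.
Proof.
move=> [Q CQ Qx]; move: {2}(pdim Q).+1 (ltnSn (pdim Q)) => k.
elim: k Q CQ Qx => // k IH Q CQ Qx; rewrite ltnS => dQ.
have [rx|nrx] := pselect (relint Q x); first by exists Q.
have [l El] := cell_rational CQ; rewrite -/(halfspaces l) in El; rewrite El in Qx nrx.
have [h hl [nh hx]] : exists2 h, h \in l &
    ~ (forall y, halfspaces l y -> dot (zvec R h.1) y = h.2) /\ dot (zvec R h.1) x = h.2.
  apply: contrapT => none; apply: nrx; apply: strict_relint => // h hl.
  have [|nh] := pselect (forall y, halfspaces l y -> dot (zvec R h.1) y = h.2); first by left.
  right; rewrite lt_neqAle Qx // andbT; apply/eqP => hx.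
  by apply: none; exists h.
pose F := halfspaces l `&` [set y | dot (zvec R h.1) y = h.2].
have faceF : face F Q.
  split; first by exists x.
  exists (zvec R h.1), h.2; split; last by rewrite /F -El.
  by rewrite El => y; apply.
have CF : cells C F by have [_ _ H _] := CC; apply: H faceF.
apply: (IH F) => //; apply: leq_trans dQ; rewrite ltnNge; apply/negP => dQF.
by apply: nh => y; rewrite -El -(face_pdim faceF dQF) => -[].
Qed.

Lemma cell_relint_sub P Q x : cells C P -> cells C Q -> relint P x -> Q x -> P `<=` Q.
Proof.
move=> CP CQ xP Qx; have [_ _ _ H] := CC.
have [|fP _] := H P Q CP CQ; first by exists x; split=> //; case: xP.
by rewrite -(face_relint fP xP) => [y []//|]; split=> //; case: xP.
Qed.

Lemma facet_eq d P Q : facets d C P -> facets d C Q -> P `<=` Q -> P = Q.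
Proof.
move=> [CP dP] [CQ dQ] PQ; have [_ _ _ H] := CC.
have PQE : P `&` Q = P by apply/setIidPl.
have [P0 _] : P !=set0 /\ rational_polyhedron P by have [_ h _ _] := CC; apply: h.
have [|_] := H P Q CP CQ; rewrite PQE // => /face_pdim; apply.
by rewrite dP dQ.
Qed.

Lemma line_open_support : line_open (~` Defs.support C).
Proof.
move=> x v nx; have [/finite_seqP[l El] _ _ _] := CC.
have [|e e0 He] := @finite_small R _ l (fun P t => ~ P (x + t *: v)).
  move=> P Pl; have CP : cells C P by rewrite El.
  by apply: line_open_setC (cell_rational CP) _ _ _ => Px; apply: nx; exists P.
exists e => // t te [P CP Px]; apply: (He t te P) => //.
by move: CP; rewrite El.
Qed.

End Cells.
End Polyhedra.

(** * The asymptotic complex in a direction *)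

Section Asymptotic.
Variables (R : realType) (n : nat) (a : 'rV[R]_n).
Implicit Types (P Q F G L O : set 'rV[R]_n) (x y z : 'rV[R]_n).

(** The points that end up in [P] when moved in the direction [a]. If [a] is a
    direction of recession of the polyhedron [P] this is [P + R a], which is again
    rational even if [a] is not; otherwise it is empty. *)
Definition asym P : set 'rV[R]_n :=
  [set x | exists t0 : R, forall t, t0 <= t -> P (x + t *: a)].

Lemma asym_shift P x k : asym P x -> asym P (x + k *: a).
Proof.
move=> [t0 Ht]; exists (t0 - k) => t tk.
by rewrite -addrA -scalerDl; apply: Ht; rewrite addrC -lerBlDr.
Qed.

Lemma asymI P Q : asym (P `&` Q) = asym P `&` asym Q.
Proof.
apply/seteqP; split=> [x [t0 H]|x [[t0 H] [t1 K]]].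
  by split; exists t0 => t /H[].
exists (Num.max t0 t1) => t; rewrite ge_max => /andP[/H ? /K ?]; by split.
Qed.

Lemma asymS P Q : P `<=` Q -> asym P `<=` asym Q.
Proof. by move=> PQ x [t0 H]; exists t0 => t /H/PQ. Qed.

Lemma asym_neq0 P : asym P !=set0 -> P !=set0.
Proof. by move=> [x [t0 /(_ t0 (lexx _))]]; eexists; eauto. Qed.

Lemma asym_dir P : asym P !=set0 -> lin_span P a.
Proof.
move=> [x [t0 H]].
have -> : a = (x + (t0 + 1) *: a) - (x + t0 *: a).
  by rewrite opprD addrACA subrr add0r -scalerBl addrAC subrr add0r scale1r.
by apply: lin_span_sub; apply: H; rewrite ?lerDl.
Qed.

(** An inequality whose linear form decreases in the direction [a] fails far enough
    along the line. *)
Lemma frequent_dir (l : seq ('rV[int]_n * R)) x :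
  (forall K : R, exists2 k, K <= k & halfspaces l (x + k *: a)) ->
  (forall h, h \in l -> 0 <= dot (zvec R h.1) a) /\ asym (halfspaces l) x.
Proof.
move=> xl.
have la h : h \in l -> 0 <= dot (zvec R h.1) a.
  move=> hl; rewrite leNgt; apply/negP => ha.
  have [k kK /(_ h hl)] := xl ((h.2 - dot (zvec R h.1) x) / dot (zvec R h.1) a + 1).
  apply/negP; rewrite -ltNge !dotE -ltrBrDl -ltr_ndivrMr //.
  by apply: lt_le_trans kK; rewrite ltrDl.
split=> //; have [k _ xk] := xl 0; exists k => t kt h hl.
apply: le_trans (xk h hl) _; rewrite !dotE lerD2l ler_wpM2r //; exact: la.
Qed.

Lemma asym_poly (l : seq ('rV[int]_n * R)) : asym (halfspaces l) !=set0 ->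
  (forall h, h \in l -> 0 <= dot (zvec R h.1) a) /\
  asym (halfspaces l) = halfspaces [seq h <- l | dot (zvec R h.1) a == 0].
Proof.
move=> [x0 [t0 H0]].
have [|la _] := @frequent_dir l x0.
  by move=> K; exists (Num.max K t0); rewrite ?le_max ?lexx //; apply: H0;
    rewrite le_max lexx orbT.
split=> //; apply/seteqP; split=> [x [t /(_ t (lexx t)) xt] h|x xl].
  rewrite mem_filter => /andP[/eqP ha hl].
  by have := xt h hl; rewrite !dotE ha mulr0 addr0.
suff [t0' Ht] : exists t0', forall h, h \in l -> forall t, t0' <= t ->
    h.2 <= dot (zvec R h.1) (x + t *: a).
  by exists t0' => t tt h hl; apply: Ht.
have {}xl : forall h, h \in l -> dot (zvec R h.1) a = 0 -> h.2 <= dot (zvec R h.1) x.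
  by move=> h hl ha; apply: xl; rewrite mem_filter ha eqxx.
elim: l la xl {H0} => [|h l IH] la xl; first by exists 0.
have [||t1 H1] := IH; [| |].
- by move=> g gl; apply: la; rewrite inE gl orbT.
- by move=> g gl; apply: xl; rewrite inE gl orbT.
have [t2 H2] : exists t2, forall t, t2 <= t -> h.2 <= dot (zvec R h.1) (x + t *: a).
  have := la h; rewrite inE eqxx => /(_ isT); rewrite le_eqVlt => /orP[/eqP ha|ha].
    by exists 0 => t _; rewrite !dotE -ha mulr0 addr0 xl // inE eqxx.
  exists ((h.2 - dot (zvec R h.1) x) / dot (zvec R h.1) a) => t.
  by rewrite ler_pdivrMr // lerBlDl !dotE.
exists (Num.max t1 t2) => g; rewrite inE => /orP[/eqP->|/H1 {}H1] t;
  by rewrite ge_max => /andP[? ?]; auto.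
Qed.

Section OnePolyhedron.
Variable P : set 'rV[R]_n.
Hypotheses (Prat : rational_polyhedron P) (P0 : asym P !=set0).

Lemma asym_rational : rational_polyhedron (asym P).
Proof.
move: P0; have [l El] := Prat; rewrite El -/(halfspaces l) => /asym_poly[_ ->].
by eexists.
Qed.

Lemma shift_mem x t : P x -> 0 <= t -> P (x + t *: a).
Proof.
move: P0; have [l El] := Prat; rewrite El -/(halfspaces l) => /asym_poly[la _] xl t0 h hl.
by apply: le_trans (xl h hl) _; rewrite !dotE lerDl mulr_ge0 //; apply: la.
Qed.

Lemma sub_asym : P `<=` asym P.
Proof. by move=> x Px; exists 0 => t t0; apply: shift_mem. Qed.

(** Moving two points far enough does not change their difference. *)
Lemma asym_span : lin_span (asym P) = lin_span P.
Proof.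
apply/seteqP; split; last by apply: lin_spanS; apply: sub_asym.
apply: lin_span_min => // x y [t0 Hx] [t1 Hy].
have -> : x - y = (x + Num.max t0 t1 *: a) - (y + Num.max t0 t1 *: a).
  by rewrite opprD addrACA subrr addr0.
by apply: lin_span_sub; [apply: Hx|apply: Hy]; rewrite le_max lexx ?orbT.
Qed.

Lemma asym_pdim : pdim (asym P) = pdim P.
Proof. by apply/eqP; rewrite eqn_leq !pdimS // asym_span. Qed.

(** [asym P] is a union of lines of direction [a], and an affine function that is
    bounded below on a line is constant on it. *)
Lemma asym_bound (c : 'rV[R]_n) b :
  (forall x, asym P x -> b <= dot c x) -> dot c a = 0.
Proof.
move=> cb; apply: contrapT => /eqP ca; have [x Px] := P0.
have := cb _ (asym_shift ((b - dot c x - 1) / dot c a) Px).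
rewrite !dotE divfK //; lra.
Qed.

Lemma asym_level (c : 'rV[R]_n) b : dot c a = 0 ->
  asym (P `&` [set x | dot c x = b]) = asym P `&` [set x | dot c x = b].
Proof.
move=> ca; rewrite asymI; apply/seteqP; split=> [x [Px [t0 H]]|x [Px cx]]; split=> //.
  by have := H t0 (lexx _); rewrite /= !dotE ca mulr0 addr0.
by exists 0 => t _; rewrite /= !dotE ca mulr0 addr0.
Qed.

Lemma asym_face_inv G : face G (asym P) -> exists2 F, face F P & G = asym F.
Proof.
move=> [G0 [c [b [cb EG]]]]; have ca := asym_bound cb.
exists (P `&` [set x | dot c x = b]); last by rewrite asym_level.
split; last by exists c, b; split=> // x /sub_asym/cb.
by apply: asym_neq0; rewrite asym_level // -EG.
Qed.

Lemma face_asym F : face F P -> asym F !=set0 ->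
  face (asym F) (asym P) /\ (asym P `<=` asym F -> P `<=` F).
Proof.
move=> [_ [c [b [Pb EF]]]] [x Fx]; have [t0 Ht] := Fx.
have ca : dot c a = 0.
  have := Ht t0 (lexx _); have := Ht (t0 + 1) (_ : t0 <= _).
  rewrite lerDl ler01 EF => /(_ isT)[_ /= h1] [_ /= h2].
  by move: h1 h2; rewrite !dotE; lra.
have EF' : asym F = asym P `&` [set x | dot c x = b] by rewrite EF asym_level.
split.
  split; first by exists x.
  exists c, b; split=> // y [t1 /(_ t1 (lexx _))/Pb].
  by rewrite !dotE ca mulr0 addr0.
by rewrite EF' EF => h y Py; split=> //; have [] := h y (sub_asym Py).
Qed.

Lemma relint_shift x t : relint P x -> 0 <= t -> relint P (x + t *: a).
Proof.
move=> [Px xP] t0; split=> [|y Py]; first exact: shift_mem.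
have [e e0 Pe] := xP y Py; exists e => //.
have -> : x + t *: a - e *: (y - (x + t *: a)) =
    (x - e *: (y - x)) + (t + e * t) *: a.
  by apply/rowP => i; rewrite !mxE; ring.
by apply: shift_mem => //; rewrite addr_ge0 // mulr_ge0 // ltW.
Qed.

End OnePolyhedron.

Section Complex.
Variables (d : nat) (C : wcomplex R n).
Hypothesis CC : polyhedral_complex C.

(** The weights are 1 because a cycle has weight 1 at its points of degree 1. *)
Definition asym_complex : wcomplex R n :=
  WComplex (asym @` [set P | cells C P /\ asym P !=set0]) (fun=> 1%N).

(** The face [P `&` Q] of [P] has the same asymptotic points as [P], so the affine
    function that defines it is constant on [asym P], which contains [P]. *)
Lemma cells_asym_sub P Q : cells C P -> cells C Q -> asym P !=set0 ->
  asym P `<=` asym Q -> P `<=` Q.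
Proof.
move=> CP CQ [x Px] PQ; have [_ _ _ H] := CC.
have PQx : asym (P `&` Q) x by rewrite asymI; split=> //; apply: PQ.
have [|fP _] := H P Q CP CQ; first by apply: asym_neq0; exists x.
have [|_ sub] := face_asym (cell_rational CC CP) (ex_intro _ x Px) fP.
  by exists x.
have /sub : asym P `<=` asym (P `&` Q) by move=> y Py; rewrite asymI; split=> //; apply: PQ.
by move=> PPQ y /PPQ[].
Qed.

Lemma asym_inj : set_inj [set P | cells C P /\ asym P !=set0] asym.
Proof.
move=> P Q; rewrite !inE => -[CP P0] [CQ Q0] PQ.
by apply/seteqP; split; apply: cells_asym_sub; rewrite ?PQ.
Qed.

Lemma asym_polyhedral : polyhedral_complex asym_complex.
Proof.
have [fin Crat Cface CI] := CC; split=> /=.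
- by apply: finite_image; apply: sub_finite_set fin => P [].
- move=> _ [P [CP P0] <-]; split=> //; apply: asym_rational => //.
  by have [] := Crat P CP.
- move=> _ G [P [CP P0] <-] fG; have [_ Pr] := Crat P CP.
  have [F fF EG] := asym_face_inv Pr P0 fG; exists F => //; split.
    exact: Cface fF.
  by rewrite -EG; case: fG.
move=> _ _ [P [CP P0] <-] [Q [CQ Q0] <-]; rewrite -asymI => PQ0.
have [_ Pr] := Crat P CP; have [_ Qr] := Crat Q CQ.
have [fP fQ] := CI P Q CP CQ (asym_neq0 PQ0).
by split; [have [] := face_asym Pr P0 fP PQ0|have [] := face_asym Qr Q0 fQ PQ0].
Qed.

Lemma asym_weighted : weighted_complex d C -> weighted_complex d asym_complex.
Proof.
move=> [_ pure _]; split=> //; first exact: asym_polyhedral.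
move=> _ [P [CP P0] <-]; have [Q [CQ dQ] PQ] := pure P CP.
have Q0 : asym Q !=set0 by have [x Px] := P0; exists x; apply: asymS PQ _ Px.
exists (asym Q); last exact: asymS.
by split; [exists Q|rewrite asym_pdim //; apply: cell_rational CQ].
Qed.

Lemma facets_asym P : cells C P -> asym P !=set0 ->
  facets d asym_complex (asym P) <-> facets d C P.
Proof.
move=> CP P0; have Pr := cell_rational CC CP.
split=> -[_ dP]; split=> //; first by rewrite -dP asym_pdim.
  by exists P.
by rewrite asym_pdim.
Qed.

Lemma facets_at_asym P : cells C P -> asym P !=set0 ->
  facets_at d asym_complex (asym P) = asym @` facets_at d C P.
Proof.
move=> CP P0; apply/seteqP; split.
  move=> _ [[[Q [CQ Q0] <-] dQ] /= PQ]; exists Q => //; split; last first.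
    exact: (cells_asym_sub CP CQ).
  by apply/facets_asym => //; split=> //; exists Q.
move=> _ [Q [[CQ dQ] /= PQ] <-].
have Q0 : asym Q !=set0 by have [x Px] := P0; exists x; apply: asymS PQ _ Px.
by split; [apply/facets_asym|apply: asymS].
Qed.

(** Neither the directions of the cells nor the incidences change, so balancing
    is inherited when the weights are the same. *)
Lemma asym_balanced : tropical_subvariety d C ->
  (forall P, facets d C P -> asym P !=set0 -> weight C P = 1%N) ->
  tropical_subvariety d asym_complex.
Proof.
move=> [Cw bal] w1; split; first exact: asym_weighted.
move=> _ [[P [CP P0] <-] dP]; have Pr := cell_rational CC CP.
rewrite asym_pdim // in dP; have [u [ugen ubal]] := bal P (conj CP dP).
have near Q : facets_at d C P Q -> [/\ cells C Q, asym Q !=set0 & rational_polyhedron Q].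
  move=> [[CQ dQ] /= PQ]; split=> //; last exact: cell_rational CQ.
  by have [x Px] := P0; exists x; apply: asymS PQ _ Px.
pose back S := xget set0 [set Q | (cells C Q /\ asym Q !=set0) /\ asym Q = S].
have backK Q : facets_at d C P Q -> back (asym Q) = Q.
  move=> /near[CQ Q0 _]; rewrite /back; case: xgetP => [S _ [[CS S0] ES]|/(_ Q)].
    by apply: asym_inj; rewrite ?inE.
  by case; split.
exists (u \o back); rewrite facets_at_asym //; split.
  move=> _ [Q PQ <-]; have [CQ Q0 Qr] := near Q PQ.
  rewrite /= backK //; have [h1 h2 [x [e xP [e0 xQ]]]] := ugen Q PQ.
  split; rewrite ?asym_span //; exists x, e; first exact: sub_asym.
  by split=> //; apply: sub_asym.
rewrite asym_span // fsbig_image; last first.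
  move=> Q S; rewrite !inE => PQ PS; apply: asym_inj; rewrite inE.
    by have [] := near Q PQ.
  by have [] := near S PS.
rewrite (eq_fsbigr (fun Q => (weight C Q)%:R *: zvec R (u Q))) // => Q.
rewrite inE => PQ; have [CQ Q0 _] := near Q PQ.
by rewrite /= backK // w1 //; case: PQ.
Qed.

Lemma asym_support_shift x t :
  Defs.support asym_complex x -> Defs.support asym_complex (x + t *: a).
Proof.
by move=> [_ [P CP <-] Px]; exists (asym P); [exists P|apply: asym_shift].
Qed.

Lemma asym_support_sub x : Defs.support asym_complex x ->
  exists t0 : R, forall t, t0 <= t -> Defs.support C (x + t *: a).
Proof. by move=> [_ [P [CP P0] <-] [t0 H]]; exists t0 => t /H; exists P. Qed.

(** By the pigeonhole principle one of the cells contains infinitely many points of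
    the progression, and then a half-line. *)
Lemma support_asym_nat x (k0 : nat) :
  (forall k : nat, (k0 <= k)%N -> Defs.support C (x + k%:R *: a)) ->
  Defs.support asym_complex x.
Proof.
move=> xC; have [/finite_seqP[l El] _ _ _] := CC.
have [P Pl freq] : exists2 P, P \in l & forall K : nat, exists2 k, (K <= k)%N & P (x + k%:R *: a).
  apply: contrapT => none.
  have [K HK] : exists K : nat, forall P, P \in l -> forall k, (K <= k)%N -> ~ P (x + k%:R *: a).
    have : forall P, P \in l -> exists K : nat, forall k, (K <= k)%N -> ~ P (x + k%:R *: a).
      move=> P Pl; apply: contrapT => nP; apply: none; exists P => // K.
      apply: contrapT => nK; apply: nP; exists K => k kK Pk; apply: nK; by exists k.
    elim: (l) => [|P l' IH] ex; first by exists 0%N.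
    have [|K HK] := IH; first by move=> Q Ql; apply: ex; rewrite inE Ql orbT.
    have [|K' HK'] := ex P; first by rewrite inE eqxx.
    exists (maxn K K') => Q; rewrite inE => /orP[/eqP->|Ql] k; rewrite geq_max => /andP[k1 k2].
      exact: HK'.
    exact: HK.
  have [|Q CQ] := xC (maxn K k0); first by rewrite leq_maxr.
  by apply: HK; [move: CQ; rewrite El|rewrite leq_maxl].
have CP : cells C P by rewrite El.
have [l' Pl'] := cell_rational CC CP.
have [|_ Px] := @frequent_dir l' x.
  move=> K; have [k kK Pk] := freq (Num.truncn `|K|).+1; rewrite Pl' in Pk.
  exists k%:R => //; apply: le_trans (ler_norm K) _; apply: ltW.
  by apply: lt_le_trans (truncnS_gt _) _; rewrite ler_nat.
by exists (asym P); [exists P => //; split=> //; exists x; rewrite Pl'|rewrite Pl'].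
Qed.

Lemma cell_pdim_le P : weighted_complex d C -> cells C P -> (pdim P <= d)%N.
Proof.
by move=> [_ pure _] CP; have [Q [_ <-] PQ] := pure P CP; apply/pdimS/lin_spanS.
Qed.

Section Local.
Variable O : set 'rV[R]_n.
Hypothesis Cw : tropical_subvariety d C.
Hypothesis Oopen : line_open O.
Hypothesis Oshift : forall x t, O x -> 0 <= t -> O (x + t *: a).
Hypothesis OC : Defs.support C `&` O `<=` Defs.support asym_complex.

(** The facets that meet [O] are covered by finitely many asymptotic cells, so
    one of these has the same direction. *)
Lemma facet_dir Q z : facets d C Q -> Q z -> O z -> lin_span Q a.
Proof.
move=> [CQ dQ] Qz Oz; have [/finite_seqP[l El] _ _ _] := CC.
pose l' := [seq P <- l | `[< asym P !=set0 >]].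
have l'P P : P \in l' <-> cells C P /\ asym P !=set0.
  by rewrite mem_filter El; split=> [/andP[/asboolP]|[Pl P0]] //; apply/andP; split=> //; apply/asboolP.
have [[P [Pl' QP]]|none] := pselect (exists P, P \in l' /\ lin_span Q `<=` lin_span P).
  have [CP P0] := (l'P P).1 Pl'.
  rewrite (lin_span_eq QP) ?dQ; first exact: asym_dir.
  by apply: cell_pdim_le => //; case: Cw.
have [P Pl'|y [Qy Oy yl]] := @general_position _ _ Q _ l'
  (fun P => xget 0 (asym P)) (fun P => lin_span P) O z (cell_convex CC CQ) Oopen Qz Oz.
  by split=> // QP; apply: none; exists P.
have [|_ [P [CP P0] <-] Py] := @OC y; first by split=> //; exists Q.
case: (yl P); first exact/l'P.
rewrite -(asym_span (cell_rational CC CP) P0); apply: lin_span_sub => //.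
by have [x Px] := P0; apply: xgetI Px.
Qed.

(** If [c] contains the direction [a] one moves inside of [c]. Otherwise [c] is a
    ridge, and the facets around it, which contain the direction [a], have
    primitive vectors [k a] modulo the ridge. Balancing says that the weighted sum
    of the [k] vanishes. Not all [k] are zero, because a facet has integral
    directions outside of the ridge; so some facet lies on the side of [- a]. *)
Lemma cross_ridge Q c z : facets d C Q -> cells C c -> relint c z -> O z ->
  (forall v, lin_span Q v -> exists k, lin_span c (v - k *: a)) ->
  exists2 e : R, 0 < e & forall t, 0 < t < e -> Defs.support C (z - t *: a).
Proof.
move=> [CQ dQ] Cc zc Oz Qca; have Cwt := Cw.1; have [_ pure wpos] := Cwt.
have [ca|nca] := pselect (lin_span c a).
  have [e e0 He] := relint_line (cell_convex CC Cc) zc ca.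
  exists e => // t /andP[t0 te]; exists c => //; rewrite -scaleNr; apply: He.
  by rewrite normrN gtr0_norm.
have around s : facets d C s -> c `<=` s ->
    (pdim c).+1 = d /\ forall v, lin_span s v -> exists k, lin_span c (v - k *: a).
  move=> fs cs; have sa : lin_span s a by apply: facet_dir fs _ Oz; apply: cs; case: zc.
  have [_ ds] := fs; rewrite -[in X in _ = X]ds.
  by apply: pdim_line nca Qca _ => //; [apply: lin_spanS|rewrite ds].
have [s0 fs0 cs0] := pure c Cc.
have [dc _] := around s0 fs0 cs0.
have [u [ugen ubal]] := Cw.2 c (conj Cc dc).
have /choice[k Hk] : forall s, exists k, facets_at d C c s -> lin_span c (zvec R (u s) - k *: a).
  move=> s; have [fs|nfs] := pselect (facets_at d C c s); last by exists 0.
  have [us _ _] := ugen s fs; have [k Hk] := (around s fs.1 fs.2).2 _ us.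
  by exists k.
have [l [lu El]] : exists l : seq (set 'rV[R]_n), uniq l /\ facets_at d C c = [set` l].
  have /finite_seqP[l El] : finite_set (facets_at d C c).
    by have [fin _ _ _] := CC; apply: sub_finite_set fin => s [[]].
  exists (undup l); rewrite undup_uniq El; split=> //.
  by apply/seteqP; split=> s; rewrite /= mem_undup.
have lP s : s \in l <-> facets_at d C c s by rewrite El.
have sum0 : \sum_(s <- l) (weight C s)%:R * k s = 0.
  apply: contrapT => /eqP sum_neq0; apply: nca; move: ubal.
  rewrite El -fsbig_seq // => ubal.
  set K := \sum_(s <- _) _ in sum_neq0.
  suff Ka : lin_span c (K *: a).
    by rewrite -[a](scalerK sum_neq0); apply: subspaceZ.
  have -> : K *: a = \sum_(s <- l) (weight C s)%:R *: zvec R (u s)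
      - \sum_(s <- l) (weight C s)%:R *: (zvec R (u s) - k s *: a).
    rewrite -sumrB scaler_suml; apply: eq_bigr => s _.
    by rewrite scalerBr opprB addrC subrK scalerA.
  apply: subspaceB => //; rewrite big_seq_cond.
  elim/big_rec: _ => [|s v]; first by case: (subspace_lin_span c).
  move=> /andP[/lP/Hk hs _] cv.
  by apply: subspaceD => //; apply: subspaceZ.
have [s fs ks] : exists2 s, facets_at d C c s & k s < 0.
  apply: contrapT => none.
  have kge s : facets_at d C c s -> 0 <= k s.
    by move=> fs; rewrite leNgt; apply/negP => ks; apply: none; exists s.
  have fs0c : facets_at d C c s0 by split.
  have ks0 : k s0 = 0.
    move: sum0; rewrite big_seq_cond => /eqP; rewrite psumr_eq0; last first.
      by move=> s /andP[/lP/kge ? _]; rewrite mulr_ge0.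
    move=> /allP/(_ s0 ((lP s0).2 fs0c)); rewrite andbT (lP s0).2 //=.
    by rewrite mulf_eq0 pnatr_eq0 -leqn0 leqNgt wpos //= => /eqP ->.
  apply: nca; apply: (@rational_span _ _ s0 (lin_span c)) => //.
  - by apply: cell_rational CC _ fs0.1.
  - by exists z; apply: cs0; case: zc.
  - have [_ gen _] := ugen s0 fs0c; move=> y /gen[m Hm].
    rewrite -[y](subrK (m *: u s0)).
    have -> : zvec R (y - m *: u s0 + m *: u s0) =
        zvec R (y - m *: u s0) + m%:~R *: zvec R (u s0).
      by apply/rowP => i; rewrite !mxE !rmorphD /= rmorphM.
    apply: subspaceD => //; apply: subspaceZ => //.
    by have := Hk s0 fs0c; rewrite ks0 scale0r subr0.
  by apply: facet_dir fs0 _ Oz; apply: cs0; case: zc.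
have [[Cs ds] /= cs] := fs; have [_ _ [x [e xc [e0 xs]]]] := ugen s fs.
(* [z - t a] lies between [z - f w], in [c], and [x + e u s], in [s]. *)
pose w := (x - z) + e *: (zvec R (u s) - k s *: a).
have cw : lin_span c w.
  apply: subspaceD => //; first by apply: lin_span_sub => //; case: zc.
  by apply: subspaceZ => //; apply: Hk.
have [f f0 Hf] := relint_line (cell_convex CC Cc) zc cw.
pose g := f / 2; have g0 : 0 < g by rewrite /g; lra.
have zg : c (z + (- g) *: w) by apply: Hf; rewrite normrN gtr0_norm // /g; lra.
pose m := g / (1 + g).
have g1 : 0 < 1 + g by lra.
have m0 : 0 < m by rewrite divr_gt0.
have m01 : 0 <= m <= 1 by rewrite (ltW m0) ler_pdivrMr // mul1r; lra.
have sm : s (z - (- (m * e * k s)) *: a).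
  have := cell_convex CC Cs (cs _ zg) xs m01; congr s.
  by rewrite /w /m; apply/rowP => i; rewrite !mxE; field; rewrite gt_eqF //; lra.
have q0 : 0 < - (m * e * k s).
  by rewrite oppr_gt0 pmulr_rlt0 // mulr_gt0.
exists (- (m * e * k s)) => // t /andP[t0 tq]; exists s => //.
have sz : s z by apply: cs; case: zc.
have := cell_convex CC Cs sz sm (t := t / - (m * e * k s)).
rewrite divr_ge0 ?(ltW t0) ?(ltW q0) //= ler_pdivrMr // mul1r (ltW tq) => /(_ isT).
congr s; rewrite addrAC subrr add0r scalerN scalerA divfK // gt_eqF //.
Qed.

(** Near a point outside of the support, pick a line of direction [a] in general
    position, and follow it backwards from where it lies in the support. It meets
    only facets and ridges, so it cannot leave the support inside of [O], by
    [cross_ridge]. *)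
Lemma asym_support_local : Defs.support asym_complex `&` O `<=` Defs.support C.
Proof.
move=> y [[_ [P [CP P0] <-] Py] Oy]; apply: contrapT => nCy.
have [_ pure _] := Cw.1; have [Q fQ PQ] := pure P CP; have [CQ dQ] := fQ.
have {PQ}Qy : asym Q y by apply: asymS Py.
have Q0 : asym Q !=set0 by exists y.
have Qr := cell_rational CC CQ.
have [/finite_seqP[l El] _ _ _] := CC.
pose L c := [set v | exists k, lin_span c (v - k *: a)].
have LL c : subspace (L c).
  split=> [|r u w [k hu] [k' hw]].
    by exists 0; rewrite scale0r subr0; case: (subspace_lin_span c).
  exists (r * k + k'); rewrite scalerDl -scalerA opprD addrACA -scalerBr.
  by apply: subspaceD => //; apply: subspaceZ.
pose l' := [seq c <- l | `[< ~ (lin_span Q `<=` L c) >]].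
have oO' : line_open (O `&` ~` Defs.support C).
  by apply: line_openI => //; apply: line_open_support.
have [c|x [Qx [Ox nCx] xl]] := @general_position _ _ (asym Q) _ l'
  (fun c => xget 0 c) L (O `&` ~` Defs.support C) y
  (convex_rational (asym_rational Qr Q0)) oO' Qy (conj Oy nCy).
- by rewrite mem_filter => /andP[/asboolP nc _]; rewrite asym_span.
have Qsx : Defs.support asym_complex x by exists (asym Q) => //; exists Q.
have [t0 Ht0] := asym_support_sub Qsx.
pose T := [set t : R | 0 <= t /\ ~ Defs.support C (x + t *: a)].
have T0 : T 0 by split; rewrite // scale0r addr0.
have Tub t : T t -> t <= t0.
  by move=> [_ nt]; rewrite leNgt; apply/negP => /ltW/Ht0.
have Tsup : has_sup T by split; [exists 0|exists t0 => t /Tub].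
have Tle t : T t -> t <= sup T by apply: sup_upper_bound.
pose z := x + sup T *: a.
have Oz : O z by apply: Oshift => //; apply: Tle.
have Cz : Defs.support C z.
  apply: contrapT => nCz; have [e e0 He] := line_open_support CC a nCz.
  have : T (sup T + e / 2).
    split; first by rewrite addr_ge0 ?Tle // divr_ge0 // ltW.
    rewrite scalerDl addrA; apply: He; rewrite gtr0_norm; lra.
  by move=> /Tle; lra.
have [c Cc zc] := relint_cell CC Cz.
have Qc : lin_span Q `<=` L c.
  apply: contrapT => nQc; have cl' : c \in l'.
    by rewrite mem_filter; apply/andP; split; [apply/asboolP|move: Cc; rewrite El].
  apply: (xl c cl'); exists (- sup T).
  have -> : x - xget 0 c - - sup T *: a = z - xget 0 c.
    by rewrite scaleNr opprK /z addrAC.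
  by apply: lin_span_sub; case: zc => // cz _; apply: xgetI cz.
have [e e0 He] := cross_ridge fQ Cc zc Oz Qc.
have [t Tt tsup] := sup_adherent e0 Tsup; have [t_ge0 nt] := Tt.
have tlt : t < sup T.
  rewrite lt_neqAle Tle // andbT; apply/eqP => tE; apply: nt; rewrite tE; exact: Cz.
apply: nt; have -> : x + t *: a = z - (sup T - t) *: a.
  by rewrite /z scalerBl opprB addrA addrAC addrK.
by apply: He; lra.
Qed.

End Local.
End Complex.
End Asymptotic.

(** * Points of degree 1 have weight 1 *)

Section WeightOne.
Variables (R : realType) (n : nat).
Implicit Types (P Q : set 'rV[R]_n) (x y : 'rV[R]_n) (C B : wcomplex R n).

Lemma pdim_set1 x : pdim [set x] = 0%N.
Proof.
have [A [Af EA]] := lin_span_basis [set x].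
apply/eqP; rewrite -(eqP Af) mxrank_eq0; apply/eqP/row_matrixP => i.
have : lin_span [set x] (row i A) by rewrite EA /= row_sub.
move=> /(@lin_span_min _ _ _ [set 0]); rewrite row0; apply=> /=.
  by split=> // c u w -> ->; rewrite scaler0 addr0.
by move=> y z -> ->; rewrite subrr.
Qed.

Lemma pdim_le P : (pdim P <= n)%N.
Proof. by have [A [Af _]] := lin_span_basis P; rewrite -(eqP Af) rank_leq_col. Qed.

Lemma subspace_in_sum_span P Q : subspace (in_sum_span P Q).
Proof.
split=> [|c u w [u1 [u2 [Pu Qu ->]]] [w1 [w2 [Pw Qw ->]]]].
  by exists 0, 0; rewrite addr0; split=> //; case: (subspace_lin_span P); case: (subspace_lin_span Q).
exists (c *: u1 + w1), (c *: u2 + w2); rewrite scalerDr addrACA; split=> //.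
  by apply: subspaceD => //; apply: subspaceZ.
by apply: subspaceD => //; apply: subspaceZ.
Qed.

Lemma generic_displacement_exists C B : finite_set (cells C) -> finite_set (cells B) ->
  exists v, generic_displacement C B v.
Proof.
move=> /finite_seqP[lC EC] /finite_seqP[lB EB].
pose l := [seq p <- [seq (s, t) | s <- lC, t <- lB] | `[< ~ transverse p.1 p.2 >]].
have [||||p|v [_ _ Hv]] := @general_position R n setT _ l (fun=> 0)
  (fun p => in_sum_span p.1 p.2) setT 0 => //.
- by exists 1.
- rewrite mem_filter => /andP[/asboolP np _]; split; first exact: subspace_in_sum_span.
  by move=> h; apply: np => u; apply: h; rewrite -[u]subr0; apply: lin_span_sub.
exists v => s t Cs Bt stv; apply: contrapT => nst.
apply: (Hv (s, t)); last by rewrite subr0.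
rewrite mem_filter; apply/andP; split; first exact/asboolP.
by apply: allpairs_f; [move: Cs; rewrite EC|move: Bt; rewrite EB].
Qed.

Lemma stable_power_finite (L : wcomplex R n) k C : stable_power L k C -> finite_set (cells C).
Proof.
by case: k => [->|k [C' _ [[[]]]]] //; apply: finite_set1.
Qed.

(** The stable multiplicity at [x] is a sum of multiples of weights of facets
    through [x], and the only facet through a relative interior point of [Q] is
    [Q]. *)
Lemma stable_mult1 d C e B v x Q : polyhedral_complex C -> finite_set (cells B) ->
  stable_mult d C e B v x = 1%N -> facets d C Q -> relint Q x -> weight C Q = 1%N.
Proof.
move=> CC Bfin; rewrite /stable_mult; set D := [set p | _]; set f := fun p => _.
move=> sum1 fQ xQ.
have Dfin : finite_set D.
  have [Cfin _ _ _] := CC.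
  apply: sub_finite_set (finite_setX Cfin Bfin) => -[s t] [[Cs _] [Bt _] _ _ _] //.
have /finite_seqP[l' El'] := Dfin.
pose l := undup l'.
have El : D = [set` l] by rewrite El'; apply/seteqP; split=> p; rewrite /= mem_undup.
move: sum1; rewrite El -fsbig_seq ?undup_uniq // => sum1.
have [p pl fp] : exists2 p, p \in l & f p != 0%N.
  apply: contrapT => none; have : (\sum_(p <- l) f p)%N = 0%N.
    rewrite big_seq big1 // => p pl; apply/eqP; apply: contrapT => fp.
    by apply: none; exists p => //; apply/negP.
  by rewrite sum1.
have f1 : f p = 1%N.
  move: sum1; rewrite (bigD1_seq p) ?undup_uniq //= => sum1.
  by apply/eqP; rewrite eqn_leq lt0n fp andbT -[X in (_ <= X)%N]sum1 leq_addr.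
have [fp1 _ [px _] _ _] : D p by rewrite El.
have -> : Q = p.1.
  by apply: (facet_eq CC fQ fp1); exact: (cell_relint_sub CC fQ.1 fp1.1 xQ px).
by move: f1 => /eqP; rewrite /f !muln_eq1 => /andP[/andP[/eqP->]].
Qed.

Lemma weight_degree1 (K : fieldType) (val : K -> trop R) d C x Q :
  polyhedral_complex C -> degree_at val d C x 1 ->
  facets d C Q -> relint Q x -> weight C Q = 1%N.
Proof.
move=> CC [[phi _ [h [p [Ld [I [_ _ pow [Iw _ _ HI] w1]]]]]] _] fQ xQ.
move: w1; rewrite /point_weight; case: asboolP => // Ix w1.
have dn : (d <= n)%N by case: fQ => _ <-; apply: pdim_le.
move: Iw HI; set B := map_complex _ _; rewrite subnKC // subnn => Iw HI.
have Bfin : finite_set (cells B) by apply: finite_image; apply: stable_power_finite pow.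
have Cfin : finite_set (cells C) by case: CC.
have [u gu] := generic_displacement_exists Cfin Bfin.
have [_ wI] := HI u gu.
apply: (stable_mult1 (v := u) (e := n - d) CC Bfin) fQ xQ.
rewrite -(wI [set x]) ?w1 //; first by split=> //; apply: pdim_set1.
split=> // y ->; exists 1 => //=; by rewrite subrr scaler0 subr0.
Qed.

End WeightOne.

(** * Linear monomial maps *)

Section Monomial.
Variables (R : realType) (n : nat).
Implicit Types (s : {perm 'I_n}) (b c : 'I_n -> R) (p q : tspace R n) (x y : 'rV[R]_n).

(** The shift is indexed by the coordinates of the image, not by those of the
    source, which makes composites and inverses simpler to write. *)
Definition mono s b p : tspace R n := fun i => tmul (p (s i)) (tfin (b i)).

Definition maff s b x : 'rV[R]_n := \row_i (x 0 (s i) + b i).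

Lemma linear_monomialP (F : tspace R n -> tspace R n) :
  linear_monomial F <-> exists s b, F = mono s b.
Proof.
split=> [[s [a Fa]]|[s [b ->]]].
  by exists s, (fun i => a (s i)); apply/funext => p; apply/funext => i; apply: Fa.
by exists s, (fun i => b ((s^-1)%g i)) => p i; rewrite permK.
Qed.

Lemma mono_temb s b x : mono s b (temb x) = temb (maff s b x).
Proof. by apply/funext => i; rewrite /mono /temb mxE. Qed.

Lemma mono_comp s b s' b' p :
  mono s b (mono s' b' p) = mono (s * s')%g (fun i => b' (s i) + b i) p.
Proof.
apply/funext => i; rewrite /mono permM; case: (p _) => //= r.
by rewrite /tfin addrA.
Qed.

Lemma mono1 p : mono 1%g (fun=> 0) p = p.
Proof.
by apply/funext => i; rewrite /mono perm1; case: (p i) => //= r; rewrite addr0.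
Qed.

Definition mono_inv s b : tspace R n -> tspace R n :=
  mono (s^-1)%g (fun i => - b ((s^-1)%g i)).

Definition maff_inv s b : 'rV[R]_n -> 'rV[R]_n :=
  maff (s^-1)%g (fun i => - b ((s^-1)%g i)).

Lemma monoK s b : cancel (mono s b) (mono_inv s b).
Proof.
move=> p; rewrite /mono_inv mono_comp mulVg -[RHS]mono1; congr (mono _ _ p).
by apply/funext => i; rewrite subrr.
Qed.

Lemma mono_invK s b : cancel (mono_inv s b) (mono s b).
Proof.
move=> p; rewrite /mono_inv mono_comp mulgV -[RHS]mono1; congr (mono _ _ p).
by apply/funext => i; rewrite permK addrC subrr.
Qed.

Lemma maffK s b : cancel (maff s b) (maff_inv s b).
Proof. by move=> x; apply: temb_inj; rewrite -!mono_temb; exact: monoK. Qed.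

Lemma maff_invK s b : cancel (maff_inv s b) (maff s b).
Proof. by move=> x; apply: temb_inj; rewrite -!mono_temb; exact: mono_invK. Qed.

Lemma mono_iter s b k : exists c, iter k (mono s b) = mono (s ^+ k)%g c.
Proof.
elim: k => [|k [c IH]].
  by exists (fun=> 0); apply/funext => p; rewrite expg0 mono1.
exists (fun i => c (s i) + b i); apply/funext => p.
by rewrite iterS IH mono_comp -expgS.
Qed.

Lemma mono_near s b p (e : R) : 0 < e ->
  exists2 f : R, 0 < f & forall q, tbox f p q -> tbox e (mono s b p) (mono s b q).
Proof.
move=> e0; exists (e^-1 + \sum_i `|b i|)^-1.
  by rewrite invr_gt0 ltr_wpDr ?invr_gt0 // sumr_ge0.
move=> q pq i; apply: tmul_near (pq (s i)) => //.
by rewrite (bigD1 i) //= lerDl sumr_ge0.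
Qed.

Lemma mono_continuous s b : continuous (mono s b).
Proof.
move=> p A /tspace_nbhsP[e e0 eA]; apply/tspace_nbhsP.
by have [f f0 Hf] := mono_near s b p e0; exists f => // q /Hf/eA.
Qed.

Lemma mono_closure s b (A : set (tspace R n)) p :
  closure A p -> closure (mono s b @` A) (mono s b p).
Proof.
move=> /tclosureP pA; apply/tclosureP => e e0.
have [f f0 Hf] := mono_near s b p e0; have [q Aq pq] := pA f f0.
by exists (mono s b q); [exists q|apply: Hf].
Qed.

Lemma mono_inf s b p : mono s b p = tpoint_inf R n <-> p = tpoint_inf R n.
Proof.
split=> [h|->]; last by apply/funext.
rewrite -(monoK s b p) h; by apply/funext.
Qed.

Lemma dot_maff s b (u x : 'rV[R]_n) :
  dot u (maff s b x) = dot (maff (s^-1)%g (fun=> 0) u) x + dot u (\row_i b i).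
Proof.
rewrite /dot [in RHS](reindex_inj (@perm_inj _ s)) /= -big_split; apply: eq_bigr => i _.
by rewrite !mxE permK addr0 mulrDr.
Qed.

Lemma maffB s b (x y : 'rV[R]_n) :
  maff s b x - maff s b y = (x - y) *m \matrix_(i, j) (i == s j)%:R.
Proof.
apply/rowP => j; rewrite !mxE (bigD1 (s j)) //= !mxE eqxx mulr1 big1 ?addr0.
  by rewrite opprD addrACA subrr addr0.
by move=> i /negPf ij; rewrite mxE ij mulr0.
Qed.

Lemma maff_inv_image s b (P : set 'rV[R]_n) : maff_inv s b @` (maff s b @` P) = P.
Proof.
apply/seteqP; split=> [_ [_ [x Px <-] <-]|x Px]; first by rewrite maffK.
by exists (maff s b x); [exists x|rewrite maffK].
Qed.

Lemma maff_image s b (P : set 'rV[R]_n) : maff s b @` P = maff_inv s b @^-1` P.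
Proof.
apply/seteqP; split=> [_ [x Px <-]|x Px]; first by rewrite /preimage /= maffK.
by exists (maff_inv s b x) => //; rewrite maff_invK.
Qed.

Lemma pdim_maff_le s b (P : set 'rV[R]_n) : (pdim (maff s b @` P) <= pdim P)%N.
Proof.
set M := \matrix_(i, j) (i == s j)%:R : 'M[R]_n.
have [A [Af EA]] := lin_span_basis P.
have [B [Bf EB]] := lin_span_basis (maff s b @` P).
have sub : lin_span (maff s b @` P) `<=` [set v | (v <= A *m M)%MS].
  apply: lin_span_min; first exact: subspace_mx.
  move=> _ _ [x Px <-] [y Py <-]; rewrite /= maffB; apply: submxMr.
  by have := lin_span_sub Px Py; rewrite EA.
have : (B <= A *m M)%MS.
  by apply/row_subP => i; apply: (sub (row i B)); rewrite EB /= row_sub.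
move=> /mxrankS; rewrite (eqP Bf) => /leq_trans; apply.
by rewrite -[X in (_ <= X)%N](eqP Af) mxrankM_maxl.
Qed.

Lemma pdim_maff s b (P : set 'rV[R]_n) : pdim (maff s b @` P) = pdim P.
Proof.
apply/eqP; rewrite eqn_leq pdim_maff_le /= -{1}(maff_inv_image s b P).
exact: pdim_maff_le.
Qed.

Lemma rational_maff s b (P : set 'rV[R]_n) :
  rational_polyhedron P -> rational_polyhedron (maff s b @` P).
Proof.
move=> [l ->]; rewrite maff_image.
set t := (s^-1)%g; set c := fun i => - b (t i).
exists [seq ((\row_i h.1 0 ((t^-1)%g i) : 'rV[int]_n), h.2 - dot (zvec R h.1) (\row_i c i)) |
  h : 'rV[int]_n * R <- l].
have E (z : 'rV[int]_n) x : dot (zvec R z) (maff t c x) =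
    dot (zvec R (\row_i z 0 ((t^-1)%g i))) x + dot (zvec R z) (\row_i c i).
  rewrite dot_maff; congr (dot _ x + _).
  by apply/rowP => i; rewrite !mxE addr0.
apply/seteqP; split=> x /= xl => [_ /mapP[h hl ->]|h hl] /=.
  by rewrite lerBlDr -E; apply: xl.
by rewrite /maff_inv -/t -/c E -lerBlDr; have := xl _ (map_f _ hl).
Qed.

Lemma face_maff s b (F P : set 'rV[R]_n) : face F P -> face (maff s b @` F) (maff s b @` P).
Proof.
move=> [[x Fx] [u [r [Pr EF]]]]; split; first by exists (maff s b x), x.
set t := (s^-1)%g; set c := fun i => - b (t i).
exists (maff (t^-1)%g (fun=> 0) u), (r - dot u (\row_i c i)); rewrite !maff_image.
have E y : dot u (maff_inv s b y) = dot (maff (t^-1)%g (fun=> 0) u) y + dot u (\row_i c i).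
  exact: dot_maff.
split=> [y /Pr|]; first by rewrite E lerBlDr.
rewrite EF; apply/seteqP; split=> y [Py /= yr]; split=> //=.
  by rewrite -yr E addrK.
by rewrite E yr subrK.
Qed.

Lemma map_complex_weighted s b d (C : wcomplex R n) :
  weighted_complex d C -> weighted_complex d (map_complex (maff s b) C).
Proof.
move=> [[fin Crat Cface CI] pure wpos].
have preK P : maff s b @^-1` (maff s b @` P) = P.
  apply/seteqP; split=> [x [y Py /(can_inj (maffK s b)) <-] //|x Px]; by exists x.
split.
- split=> /=.
  + exact: finite_image.
  + move=> _ [P /Crat[[x Px] Pr] <-]; split; first by exists (maff s b x), x.
    exact: rational_maff.
  + move=> _ G [P CP <-] fG; exists (maff_inv s b @` G); last first.
      apply/seteqP; split=> [_ [_ [x Gx <-] <-]|x Gx]; first by rewrite maff_invK.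
      by exists (maff_inv s b x); [exists x|rewrite maff_invK].
    apply: Cface CP _; rewrite -(maff_inv_image s b P); exact: face_maff.
  + move=> _ _ [P CP <-] [Q CQ <-]; rewrite maff_image (maff_image _ _ Q) -preimage_setI.
    rewrite -!maff_image => -[_ [x PQx _]].
    have [|fP fQ] := CI P Q CP CQ; first by exists x.
    by split; apply: face_maff.
- move=> _ [P CP <-]; have [Q [CQ dQ] PQ] := pure P CP.
  exists (maff s b @` Q); last exact: image_subset.
  by split; [exists Q|rewrite pdim_maff].
move=> _ [[P CP <-] dP] /=; rewrite preK; apply: wpos.
by split=> //; rewrite pdim_maff in dP.
Qed.

Lemma laurent_mono s b r (m : 'I_n -> int) p :
  laurent_monomial r m (mono s b p) =
  laurent_monomial (r + \sum_i b i *~ m i) (fun i => m ((s^-1)%g i)) p.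
Proof.
rewrite /laurent_monomial.
have -> : [exists i, (m i != 0) && (mono s b p i == None :> option R)] =
    [exists i, (m ((s^-1)%g i) != 0) && (p i == None :> option R)].
  apply/existsP/existsP => -[i].
    rewrite /mono => /andP[mi pi]; exists (s i); rewrite permK mi /=.
    by move: pi; case: (p (s i)).
  move=> /andP[mi pi]; exists ((s^-1)%g i); rewrite mi /mono permKV.
  by move: pi; case: (p i).
case: existsP => // none; congr tfin; rewrite -addrA; congr (r + _).
rewrite [X in _ = _ + X](reindex_inj (@perm_inj _ s)) /= -big_split /=.
apply: eq_bigr => i _; rewrite permK; have [->|mi] := eqVneq (m i) 0; first by rewrite !mulr0z addr0.
rewrite /mono; case E: (p (s i)) => [t|] /=; first by rewrite mulrzDl addrC.
by case: none; exists (s i); rewrite permK mi E.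
Qed.

(** * Contracting translations *)

Lemma mono_iter1 b k p : iter k (mono 1%g b) p = mono 1%g (fun i => b i *+ k) p.
Proof.
elim: k => [|k IH] /=; first by rewrite mono1.
rewrite IH mono_comp mulg1; congr (mono _ _ p).
by apply/funext => i; rewrite perm1 mulrSr.
Qed.

Lemma contracting_iter s b k : contracting (mono s b) -> forall U : set (tspace R n),
  open U -> U (tpoint_inf R n) -> exists V : set (tspace R n),
    [/\ open V, V (tpoint_inf R n), V `<=` U & closure (iter k.+1 (mono s b) @` V) `<=` V].
Proof.
move=> Fc U Uo Uinf; have [V [Vo Vinf VU FV]] := Fc U Uo Uinf.
exists V; split=> //; apply: (subset_trans _ FV); apply: closure_subset.
have FV' p : V p -> V (mono s b p).
  by move=> Vp; apply: FV; apply: subset_closure; exists p.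
move=> _ [p Vp <-]; exists (iter k (mono s b) p) => //.
by elim: k => //= k; apply: FV'.
Qed.

(** On the line of points whose [i]-th coordinate alone is finite, [V] is bounded
    below. The translate by [b i] of its lower end is in the closure of the
    translate of [V], hence in [V]; since [V] is open, it contains points of the
    line a little below, and [b i <= 0] would put them below the lower end. *)
Lemma contracting_gt0 b :
  (forall U : set (tspace R n), open U -> U (tpoint_inf R n) ->
     exists V : set (tspace R n), [/\ open V, V (tpoint_inf R n), V `<=` U &
       closure (mono 1%g b @` V) `<=` V]) ->
  forall i, 0 < b i.
Proof.
move=> Fc i; rewrite ltNge; apply/negP => bi.
have [V [Vo Vinf VU FV]] := Fc _ (@open_far R n 0) (@far_inf R n 0).
pose x (t : R) : tspace R n := fun j => if j == i then tfin t else tinf R.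
pose T := [set t | V (x t)].
have [M MV] : exists M : R, far M `<=` V by apply/nbhs_infP/open_nbhs_nbhs.
have T0 : T !=set0.
  by exists (M + 1); apply: MV => j; rewrite /x; case: eqP => //= _; rewrite ltrDl ltr01.
have T_ge0 t : T t -> 0 <= t.
  by move=> /VU/(_ i); rewrite /x eqxx => /ltW.
have Tinf : has_inf T by split=> //; exists 0 => t /T_ge0.
have xb t : mono 1%g b (x t) = x (t + b i).
  by apply/funext => j; rewrite /mono perm1 /x; case: eqP => // ->.
have : V (x (inf T + b i)).
  apply: FV; apply/tclosureP => e e0; have [t Tt te] := inf_adherent e0 Tinf.
  exists (x (t + b i)); first by exists (x t).
  move=> j; rewrite /x; case: eqP => //= _.
  have tinf_le : inf T <= t by apply: ge_inf => //; case: Tinf.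
  by rewrite opprD addrACA subrr addr0 ger0_norm ?subr_ge0 // ltrBlDl.
move=> Vx; have /tspace_nbhsP[e e0 eV] : nbhs (x (inf T + b i)) V by apply: open_nbhs_nbhs.
have : T (inf T + b i - e / 2).
  apply: eV => j; rewrite /x; case: eqP => //= _.
  by rewrite addrAC subrr add0r normrN gtr0_norm; lra.
have Tl : lbound T (inf T) by apply: inf_lbound; case: Tinf.
by move=> /Tl; lra.
Qed.

Lemma translation_contracting b : (forall i, 0 < b i) -> contracting (mono 1%g b).
Proof.
move=> b0 U Uo Uinf; have [M MU] : exists M : R, far M `<=` U by apply/nbhs_infP/open_nbhs_nbhs.
exists (far M); split=> //; first exact: open_far.
move=> q /tclosureP qM i; case Eq: (q i) => [t|] //.
have [_ [p pM <-] /(_ i)] := qM (b i) (b0 i); have := pM i.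
rewrite /mono perm1 Eq; case: (p i) => //= r Mr; rewrite ltr_norml => /andP[_ h].
lra.
Qed.

Lemma far_eventually b p (M : R) : (forall i, 0 < b i) ->
  exists k0 : nat, forall k, (k0 <= k)%N -> far M (iter k (mono 1%g b) p).
Proof.
move=> b0.
have /choice[k Hk] : forall i, exists k0 : nat, forall k, (k0 <= k)%N ->
    if p i is Some r then M < r + b i *+ k else true.
  move=> i; case: (p i) => [r|]; last by exists 0%N.
  exists (Num.truncn `|(M - r) / b i|).+1 => k kk.
  rewrite -ltrBlDl -mulr_natr -ltr_pdivrMl // mulrC.
  apply: le_lt_trans (ler_norm _) _; apply: lt_le_trans (truncnS_gt _) _.
  by rewrite ler_nat.
exists (\max_i k i)%N => m km i; rewrite mono_iter1 /mono perm1.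
have := Hk i m (leq_trans (leq_bigmax i) km).
by case: (p i).
Qed.

End Monomial.

(** * Quotients by a power of the contraction *)

Section Quotient.
Variables (R : realType) (n : nat) (X : set (tspace R n)).

Section HopfPi.
Variable F : tspace R n -> tspace R n.

Lemma hopf_piP (x y : set_type (punctured X)) : hopf_pi F x = hopf_pi F y <->
  exists j k, iter j F (val x) = iter k F (val y).
Proof. by split=> [/eqmodP/asboolP|h] //; apply/eqmodP/asboolP. Qed.

Definition hopf_repr (t : hopf_manifold X F) : set_type (punctured X) :=
  generic_quotient.repr (t : {eq_quot hopf_equiv X F}%qT).

Lemma hopf_reprK (t : hopf_manifold X F) : hopf_pi F (hopf_repr t) = t.
Proof. exact: generic_quotient.reprK. Qed.

Lemma open_hopf (A : set (hopf_manifold X F)) : open A <-> open (hopf_pi F @^-1` A).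
Proof. by []. Qed.

Lemma hopf_pi_continuous : continuous (@hopf_pi R n X F).
Proof. exact: pi_continuous. Qed.

End HopfPi.

Variables (s : {perm 'I_n}) (b : 'I_n -> R).
Let F := mono s b.
Hypothesis XF : F @` X `<=` X.

Lemma punctured_mono p : punctured X p -> punctured X (F p).
Proof.
move=> [Xp pinf]; split; first by apply: XF; exists p.
by move=> /mono_inf h; apply: pinf; rewrite h.
Qed.

Definition restr (x : set_type (punctured X)) : set_type (punctured X) :=
  SigSub (mem_set (punctured_mono (set_valP x))).

Lemma val_restr k x : val (iter k restr x) = iter k F (val x).
Proof. by elim: k => //= k IH; rewrite -IH. Qed.

Lemma restr_continuous k : continuous (iter k restr).
Proof.
apply: continuous_comp_initial => x.
have [b' Fk] := mono_iter s b k.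
have -> : set_val \o iter k restr = mono (s ^+ k)%g b' \o set_val.
  by apply/funext => y /=; rewrite -Fk; apply: val_restr.
apply: continuous_comp; first exact: initial_continuous.
exact: mono_continuous.
Qed.

(** What [affine_at] requires of the lift of a function, stated on the germ, where
    it can be pulled back along the contraction. *)
Definition locally_laurent (f : set_type (punctured X) -> trop R)
    (x : set_type (punctured X)) :=
  exists (c : R) (m : 'I_n -> int),
    (forall i, val x i = tinf R -> 0 <= m i) /\
    \forall y \near x, f y = laurent_monomial c m (val y).

Lemma locally_laurent_restr k f x :
  locally_laurent f (iter k restr x) -> locally_laurent (f \o iter k restr) x.
Proof.
move=> [c [m [reg fm]]]; have [b' Fk] := mono_iter s b k.
exists (c + \sum_i b' i *~ m i), (fun i => m (((s ^+ k)^-1)%g i)); split=> [i xi|].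
  apply: reg; rewrite val_restr -/F Fk /mono permKV xi //.
have fm' : nbhs x (iter k restr @^-1` [set y | f y = laurent_monomial c m (val y)]) :=
  @restr_continuous k x _ fm.
apply: filterS fm' => y; rewrite /preimage /= => ->.
by rewrite val_restr -/F Fk laurent_mono.
Qed.

Section Group.
Variable m : nat.
Let G := iter m.+1 F.
Notation HG := (hopf_manifold X G).
Notation HF := (hopf_manifold X F).

Lemma iterG j p : iter j G p = iter (j * m.+1) F p.
Proof. by rewrite iterM. Qed.

Definition hopf_act (t : HG) (g : 'I_m.+1) : HG := hopf_pi G (iter g restr (hopf_repr t)).

Lemma hopf_act_pi x g : hopf_act (hopf_pi G x) g = hopf_pi G (iter g restr x).
Proof.
have /hopf_piP[j [k jk]] : hopf_pi G (hopf_repr (hopf_pi G x)) = hopf_pi G x.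
  exact: hopf_reprK.
apply/hopf_piP; exists j, k; rewrite !val_restr !iterG -!iterD ![(_ + g)%N]addnC !iterD.
by rewrite -!iterG jk.
Qed.

Lemma hopf_act1 : hopf_act^~ 1%g =1 id.
Proof. by move=> t; rewrite -[t]hopf_reprK hopf_act_pi. Qed.

Lemma hopf_actM : forall t, act_morph hopf_act t.
Proof.
move=> t g h; rewrite -[t]hopf_reprK !hopf_act_pi.
apply/hopf_piP; exists ((g + h) %/ m.+1)%N, 0%N.
rewrite !val_restr iterG -iterD /=.
have -> : (((g + h) %/ m.+1) * m.+1 + (g * h)%g)%N = (h + g)%N.
  by rewrite [RHS]addnC [RHS](divn_eq (g + h)%N m.+1).
by rewrite iterD.
Qed.

Canonical hopf_action := TotalAction hopf_act1 hopf_actM.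

Definition hopf_cover (t : HG) : HF := hopf_pi F (hopf_repr t).

Lemma hopf_cover_pi x : hopf_cover (hopf_pi G x) = hopf_pi F x.
Proof.
have /hopf_piP[j [k jk]] : hopf_pi G (hopf_repr (hopf_pi G x)) = hopf_pi G x.
  exact: hopf_reprK.
by apply/hopf_piP; exists (j * m.+1)%N, (k * m.+1)%N; rewrite -!iterG.
Qed.

(** Two points in the same orbit of [F] become equivalent for [F^(m+1)] after a
    suitable number of steps, which matters modulo [m+1] only. *)
Lemma hopf_orbit x y : hopf_pi F x = hopf_pi F y ->
  exists g : 'I_m.+1, hopf_pi G y = hopf_pi G (iter g restr x).
Proof.
move=> /hopf_piP[j [k jk]].
pose r := (j + k * m)%N.
exists (inord (r %% m.+1)); apply/hopf_piP; exists k, (r %/ m.+1)%N.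
rewrite inordK ?ltn_mod // val_restr !iterG -iterD -divn_eq /r.
by rewrite addnC iterD jk -iterD -mulnSr.
Qed.

Lemma hopf_act_morphism g : tropical_morphism (fun t : HG => hopf_act t g).
Proof.
have actE : (fun t : HG => hopf_act t g) \o hopf_pi G = hopf_pi G \o iter g restr.
  by apply/funext => x; apply: hopf_act_pi.
split.
  apply: (quotient_continuous _).2; rewrite actE => x.
  by apply: continuous_comp; [apply: restr_continuous|apply: hopf_pi_continuous].
move=> h t ht x xt; rewrite -[t]xt hopf_act_pi in ht *.
have := locally_laurent_restr (ht _ erefl).
congr (locally_laurent _ x); apply/funext => y /=; congr h.
by rewrite hopf_act_pi.
Qed.

Lemma finite_quotient_iter : finite_quotient X G X F.
Proof.
exists 'I_m.+1, hopf_action, hopf_cover; split.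
- exact: hopf_act_morphism.
- move=> t; exists (hopf_pi G (hopf_repr t)); rewrite hopf_cover_pi; exact: hopf_reprK.
- move=> t u; rewrite -[t]hopf_reprK -[u]hopf_reprK !hopf_cover_pi.
  split=> [/hopf_orbit[g ->]|[g]]; first by exists g; rewrite /= hopf_act_pi.
  move=> /(congr1 hopf_cover); rewrite [hopf_action _ _]hopf_act_pi !hopf_cover_pi => ->.
  apply/hopf_piP.
  by exists g, 0%N; rewrite val_restr.
- move=> A; rewrite (open_hopf A) (open_hopf (hopf_cover @^-1` A)).
  suff -> : hopf_pi G @^-1` (hopf_cover @^-1` A) = hopf_pi F @^-1` A by [].
  by apply/seteqP; split=> x; rewrite /preimage /= hopf_cover_pi.
move=> h t; rewrite -[t]hopf_reprK hopf_cover_pi; set x := hopf_repr t.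
have coverE : (h \o hopf_cover) \o hopf_pi G = h \o hopf_pi F.
  by apply/funext => y /=; rewrite hopf_cover_pi.
split=> hx y.
  move=> /(congr1 hopf_cover); rewrite !hopf_cover_pi => /hx.
  by rewrite -[X in _ -> X]/(locally_laurent ((h \o hopf_cover) \o hopf_pi G) y) coverE.
(* The points of the fibre over [t] are moved into the class of [x] by a power of
   the contraction, along which local expressions can be pulled back. *)
move=> /hopf_orbit[g] /esym/hx.
rewrite -[X in X -> _]/(locally_laurent ((h \o hopf_cover) \o hopf_pi G) _).
rewrite coverE => /locally_laurent_restr.
congr (locally_laurent _ y); apply/funext => z /=; congr h.
by apply/hopf_piP; exists 0%N, g; rewrite val_restr.
Qed.

End Group.
End Quotient.

(** * Germs that are invariant under a contraction *)

(** Finite unions of polyhedra are closed. *)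
Lemma tclosure_temb (R : realType) n (C : wcomplex R n) (x : 'rV[R]_n) :
  polyhedral_complex C -> tclosure C (temb x) -> Defs.support C x.
Proof.
move=> CC /tclosureP Cx; apply: contrapT => nx; have [/finite_seqP[l El] _ _ _] := CC.
have [|e e0 He] := @finite_small R _ l
    (fun P t => forall y : 'rV[R]_n, (forall i, `|y 0 i - x 0 i| < `|t|) -> ~ P y).
  move=> P Pl; have CP : cells C P by rewrite El.
  have [g Eg] := cell_rational CC CP; rewrite -/(halfspaces g) in Eg.
  have [h hg hx] : exists2 h, h \in g & dot (zvec R h.1) x < h.2.
    apply: contrapT => none; apply: nx; exists P => //; rewrite Eg => h hg.
    by rewrite leNgt; apply/negP => hx; apply: none; exists h.
  pose m := \sum_i `|zvec R h.1 0 i| + 1.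
  have m0 : 0 < m by rewrite ltr_wpDl // sumr_ge0.
  exists ((h.2 - dot (zvec R h.1) x) / m) => [|t]; first by rewrite divr_gt0 // subr_gt0.
  rewrite ltr_pdivlMr // => tm y yx; rewrite Eg => /(_ h hg); apply/negP; rewrite -ltNge.
  have : dot (zvec R h.1) (y - x) <= `|t| * m.
    apply: (@le_trans _ _ (`|t| * \sum_i `|zvec R h.1 0 i|)); last first.
      by rewrite ler_wpM2l // lerDl.
    rewrite mulr_sumr ler_sum // => i _; apply: le_trans (ler_norm _) _.
    rewrite normrM mulrC ler_wpM2r // !mxE; apply/ltW/yx.
  by rewrite !dotE; lra.
have [|_ [y [P CP Py] <-] /tbox_temb[y' /temb_inj <- yx]] := Cx (e / 2); first by lra.
apply: (He (e / 2)) Py; [|by move: CP; rewrite El|].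
  rewrite gtr0_norm; lra.
move=> i; apply: lt_le_trans (yx i) _; exact: ler_norm.
Qed.

Lemma line_open_far (R : realType) n (M : R) :
  line_open [set x : 'rV[R]_n | far M (temb x)].
Proof.
move=> x v xM; have [e e0 He] := far_box (xM : far M (temb x)).
have m0 : 0 < \sum_i `|v 0 i| + 1 by rewrite ltr_wpDl // sumr_ge0.
exists (e / (\sum_i `|v 0 i| + 1)) => [|t]; first by rewrite divr_gt0.
rewrite ltr_pdivlMr // => te; apply: He => i; rewrite /temb /= !mxE addrAC subrr add0r.
apply: le_lt_trans te; rewrite normrM ler_wpM2l //.
by rewrite (bigD1 i) //= -addrA lerDl addr_ge0 // sumr_ge0.
Qed.

Lemma maff1 (R : realType) n (c : 'I_n -> R) (t : R) (x : 'rV[R]_n) :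
  maff 1%g (fun i => t * c i) x = x + t *: \row_i c i.
Proof. by apply/rowP => i; rewrite !mxE perm1. Qed.

Section InvariantGerm.
Variables (R : realType) (n : nat) (X : germ R n).
Variables (s : {perm 'I_n}) (b c : 'I_n -> R) (m : nat).
Let F := mono s b.
Let f := maff s b.
Let a := \row_i c i.
Let d := gdim X.
Let C := gcomplex X.
Hypothesis XF : F @` gset X `<=` gset X.
Hypothesis Fm : iter m.+1 F = mono 1%g c.
Hypothesis c0 : forall i, 0 < c i.
Hypothesis CT : tropical_subvariety d C.
Hypothesis Xnbhs : nbhs (tpoint_inf R n) (gnbhd X).
Hypothesis weight1 : forall Q x, facets d C Q -> relint Q x -> gnbhd X (temb x) ->
  weight C Q = 1%N.

Let CC : polyhedral_complex C.
Proof. by case: CT => [[]]. Qed.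

Let V := asym_complex a C.

Lemma germ_iter k p : gset X p -> gset X (iter k F p).
Proof. by move=> Xp; elim: k => //= k IH; apply: XF; eexists; eauto. Qed.

Lemma iter_translation k p :
  iter k (mono 1%g c) p = mono 1%g (fun i => k%:R * c i) p.
Proof.
rewrite mono_iter1; congr (mono _ _ p); apply/funext => i.
by rewrite mulr_natl.
Qed.

Lemma germ_translate k p : gset X p -> gset X (mono 1%g (fun i => k%:R * c i) p).
Proof. by rewrite -iter_translation -Fm -iterM; apply: germ_iter. Qed.

Lemma temb_translate (t : R) x : mono 1%g (fun i => t * c i) (temb x) = temb (x + t *: a).
Proof. by rewrite mono_temb maff1. Qed.

Lemma support_germ x : Defs.support C x -> gnbhd X (temb x) -> gset X (temb x).
Proof. by move=> Cx nx; split=> //; apply: subset_closure; exists x. Qed.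

Lemma germ_support x : gset X (temb x) -> Defs.support C x.
Proof. by move=> [/(tclosure_temb CC)]. Qed.

(** Close to infinity the germ is stable under the translation, so one inclusion is
    [support_asym_nat] and the other one is [asym_support_local]. *)
Lemma far_germ : exists2 M : R, far M `<=` gnbhd X &
  forall x, far M (temb x) -> Defs.support V x <-> Defs.support C x.
Proof.
have [M MX] := (nbhs_infP (gnbhd X)).1 Xnbhs; exists M => //.
have CV : Defs.support C `&` [set x | far M (temb x)] `<=` Defs.support V.
  move=> x [Cx xM]; apply: (support_asym_nat (k0 := 0%N) CC) => k _.
  apply: germ_support; rewrite -temb_translate; apply: germ_translate.
  by apply: support_germ => //; apply: MX.
move=> x xM; split=> [Vx|Cx]; last exact: CV.
apply: (asym_support_local CC CT (@line_open_far R n M) _ CV); last by split.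
move=> y t yM t0 i; apply: lt_le_trans (yM i) _.
by rewrite !mxE lerDl mulr_ge0 // ltW.
Qed.

Lemma far_translate x (M : R) : exists k0 : nat, forall k, (k0 <= k)%N ->
  far M (temb (x + k%:R *: a)).
Proof.
have [k0 Hk] := far_eventually (temb x) M c0; exists k0 => k /Hk.
by rewrite iter_translation temb_translate.
Qed.

(** A facet with an asymptotic point has relative interior points in every
    neighbourhood of infinity, in particular in the germ, where the weight is 1. *)
Lemma asym_subvariety : tropical_subvariety d V.
Proof.
apply: asym_balanced => // P fP P0; have Pr := cell_rational CC fP.1.
have [x xP] := relint_exists Pr (asym_neq0 P0).
have [M MX _] := far_germ; have [k /(_ k (leqnn k)) xM] := far_translate x M.
by apply: weight1 (relint_shift Pr P0 xP (ler0n _ k)) _ => //; apply: MX.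
Qed.

Lemma tclosureV_far M p : (forall x, far M (temb x) -> Defs.support V x <-> Defs.support C x) ->
  far M p -> tclosure V p <-> tclosure C p.
Proof.
move=> VC pM; have Mo := @open_far R n M.
by split=> /(closureI_open Mo pM); apply: closure_subset => _ [[x Vx <-] xM];
  exists x => //; apply/VC.
Qed.

Lemma tclosureV_translate (t : R) p :
  tclosure V p -> tclosure V (mono 1%g (fun i => t * c i) p).
Proof.
move=> /(mono_closure (s := 1%g) (b := fun i => t * c i)); apply: closure_subset.
move=> _ [_ [x Vx <-] <-]; exists (x + t *: a); first exact: asym_support_shift.
by rewrite temb_translate.
Qed.

Lemma translateK (t : R) p :
  mono 1%g (fun i => - t * c i) (mono 1%g (fun i => t * c i) p) = p.
Proof.
rewrite mono_comp mulg1 -[RHS]mono1; congr (mono _ _ p).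
by apply/funext => i; rewrite perm1 mulNr subrr.
Qed.

(** Far away translates of a point of the germ lie in the closure of the asymptotic
    complex, which is invariant under translation in both directions. *)
Lemma germ_tclosureV : gset X `<=` tclosure V.
Proof.
move=> p Xp; have [M _ VC] := far_germ.
have [k /(_ k (leqnn k)) pM] := far_eventually p M c0.
rewrite iter_translation in pM; rewrite -(translateK k%:R p).
apply/tclosureV_translate/(tclosureV_far VC pM).
by have [] := germ_translate k Xp.
Qed.

Lemma germ_cone_nbhs : exists2 U, nbhs (tpoint_inf R n) U & gset X = tclosure V `&` U.
Proof.
have [M MX VC] := far_germ; exists (gset X `|` far M).
  by apply/nbhs_infP; exists M => p; right.
apply/seteqP; split=> [p Xp|p [Vp [//|pM]]].
  by split; [apply: germ_tclosureV|left].
by split; [apply/(tclosureV_far VC pM)|apply: MX].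
Qed.

Lemma cone_tclosureV : cone (tclosure V).
Proof.
exists c => // p [t|] Vp; last first.
  have -> : (fun i => tmul (p i) (tinf R)) = tpoint_inf R n.
    by apply/funext => i; case: (p i).
  have [|_ [x Vx _] _] := (tclosureP _ _).1 Vp 1; first by [].
  apply/tclosureP => e e0; have [k /(_ k (leqnn k)) xk] := far_translate x e^-1.
  exists (temb (x + k%:R *: a)); last by move=> i; exact: xk.
  by exists (x + k%:R *: a) => //; apply: asym_support_shift.
have := tclosureV_translate (t := t) Vp; rewrite /mono.
by under eq_fun do rewrite perm1.
Qed.

(** [F] commutes with its power, the translation. *)
Lemma f_translate k x : f (x + k%:R *: a) = f x + k%:R *: a.
Proof.
apply: temb_inj; rewrite -mono_temb -/F -!temb_translate.
rewrite -mono_temb -/F -!iter_translation -Fm -!iterM -iterS; exact: iterSr.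
Qed.

Lemma f_supportV x : Defs.support V x -> Defs.support V (f x).
Proof.
move=> Vx; have [M MX VC] := far_germ; have [k0 Hk] := far_translate x M.
apply: (support_asym_nat (k0 := k0) CC) => k kk; rewrite -f_translate.
apply: germ_support; rewrite -mono_temb; apply: XF; exists (temb (x + k%:R *: a)) => //.
apply: support_germ; last exact/MX/Hk.
by apply/VC; [exact: Hk|exact: asym_support_shift].
Qed.

(** The inverse of [F] is a power of [F] composed with a translation. *)
Lemma F_iter_inv p : F (iter m F (mono 1%g (fun i => - 1 * c i) p)) = p.
Proof.
rewrite -iterS Fm -[RHS]mono1 mono_comp mulg1; congr (mono _ _ p).
by apply/funext => i; rewrite perm1 mulN1r addNr.
Qed.

Lemma F_tclosureV p : tclosure V p -> tclosure V (F p).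
Proof.
move=> /(mono_closure (s := s) (b := b)); apply: closure_subset => _ [_ [x Vx <-] <-].
by exists (f x); [apply: f_supportV|rewrite mono_temb].
Qed.

Lemma automorphism_tclosureV : tropical_automorphism d V F.
Proof.
split.
  split=> [p /F_tclosureV //|p q _ _ /(can_inj (monoK s b)) //|p Vp].
  exists (iter m F (mono 1%g (fun i => - 1 * c i) p)); last exact: F_iter_inv.
  have : tclosure V (mono 1%g (fun i => - 1 * c i) p) by apply: tclosureV_translate.
  by move=> Vq; elim: m => //= k; apply: F_tclosureV.
exists f; first by move=> x; rewrite /F mono_temb.
have Vw : weighted_complex d V by apply: asym_weighted => //; case: CT.
split=> //; first exact: map_complex_weighted.
have suppE : Defs.support (map_complex f V) = f @` Defs.support V.
  apply/seteqP; split=> [_ [_ [P VP <-] [x Px <-]]|_ [x [P VP Px] <-]].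
    by exists x => //; exists P.
  by exists (f @` P); [exists P|exists x].
rewrite suppE; apply/seteqP; split=> [_ [x /f_supportV Vx <-] //|x Vx].
pose y := iter m f (x + (- 1) *: a).
have Ey : temb y = iter m F (mono 1%g (fun i => - 1 * c i) (temb x)).
  by rewrite temb_translate /y; elim: m => //= k <-; rewrite /F mono_temb.
exists y; last by apply: temb_inj; rewrite -mono_temb -/F Ey F_iter_inv.
rewrite /y; have : Defs.support V (x + (- 1) *: a) by apply: asym_support_shift.
by move=> Vy; elim: m => //= k; apply: f_supportV.
Qed.

End InvariantGerm.

Lemma modification_le (R : realType) n d (V : wcomplex R n) m (W : wcomplex R m) :
  modification d V W -> (n <= m)%N.
Proof. by elim=> // m' _ _ _ h _; apply: leqW. Qed.

Theorem theoremA (R : realType) (K : fieldType) (v : K -> trop R)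
    (v_val : valuation v) (n : nat) (X : germ R n)
    (F : tspace R n -> tspace R n) (XF : hopf_data v X F) :
  (exists V : wcomplex R n,
     [/\ tropical_subvariety (gdim X) V,
         exists2 U, nbhs (tpoint_inf R n) U & gset X = tclosure V `&` U,
         same_weights (gdim X) V (gcomplex X)
           [set x | gnbhd X (temb x)],
         cone (tclosure V)
       & tropical_automorphism (gdim X) V F]) /\
  (exists (d : nat) (a : 'I_d -> R) (n' : nat) (X' : germ R n')
      (F' : tspace R n' -> tspace R n'),
     [/\ forall i, 0 < a i,
         hopf_data v X' F',
         hopf_modification (affine_germ R d) (translation a) X' F'
       & finite_quotient (gset X') F' (gset X) F]).

Proof.
have [[CT Xnbhs [_ _ deg]] Xmod /linear_monomialP[s [b EF]] Fcontr XFX] := XF.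
(* After [#[s]] steps the coordinates are back in place. *)
subst F; pose m := #[s]%g.-1.
have [c Fm] : exists c, iter m.+1 (mono s b) = mono 1%g c.
  have [c Ec] := mono_iter s b m.+1; exists c.
  by rewrite Ec /m prednK ?order_gt0 // expg_order.
have c0 : forall i, 0 < c i.
  apply: contracting_gt0 => U Uo Uinf.
  by have := contracting_iter m Fcontr Uo Uinf; rewrite Fm.
have CC : polyhedral_complex (gcomplex X) by case: CT => [[]].
have w1 Q x : facets (gdim X) (gcomplex X) Q -> relint Q x -> gnbhd X (temb x) ->
    weight (gcomplex X) Q = 1%N.
  move=> fQ xQ nx; apply: (weight_degree1 CC _ fQ xQ); apply: deg => //.
  by exists Q; [case: fQ|case: xQ].
split.
  exists (asym_complex (\row_i c i) (gcomplex X)); split.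
  - exact: asym_subvariety XFX Fm c0 CT Xnbhs w1.
  - exact: germ_cone_nbhs XFX Fm c0 CT Xnbhs.
  - by move=> P Q x _ fQ _ xQ nx; rewrite (w1 Q x).
  - exact: cone_tclosureV c0.
  - exact: automorphism_tclosureV XFX Fm c0 CT Xnbhs.
(* The same germ, with the translation [F ^ #[s]] in place of [F]. *)
have dn := modification_le Xmod.
exists (gdim X), (fun i => c (widen_ord dn i)), n, X, (iter m.+1 (mono s b)); split.
- by [].
- split; first by have [] := XF.
  + exact: Xmod.
  + by apply/linear_monomialP; exists 1%g, c.
  + by rewrite Fm; apply: translation_contracting.
  + by move=> _ [p Xp <-]; apply: germ_iter.
- split=> //; exists dn; split; first by move=> _ [p Xp <-]; split=> //;
    rewrite /tclosure /Defs.support /= bigcup_set1; apply: dense_temb.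
  move=> p _; rewrite Fm; apply/funext => i.
  by rewrite /tproj /translation /mono perm1.
exact: finite_quotient_iter.
Qed.
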